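(* Let $G$ be a connected simple graph of order $n\geq 6$. Then: (a) $m(\partial^L_1(G))=n-4$ and $\partial^L_{n-1}(G)=n$ with multiplicity $3$ (i.e. $n$ is a distance Laplacian eigenvalue of $G$ of multiplicity exactly $3$) if and only if one of the following holds: - $n\equiv 0 \pmod 4$ and $G\cong K_{\frac{n}{4},\frac{n}{4},\frac{n}{4},\frac{n}{4}}$; - $n\equiv 1 \pmod 3$ and $G\cong K_{\frac{n-1}{3},\frac{n-1}{3},\frac{n-1}{3},1}$; - $n\equiv 2 \pmod 2$ (i.e. $n$ is even) and $G\cong K_{\frac{n-2}{2},\frac{n-2}{2},1,1}$; - $G\cong SK_{n,n-3}$. (b) $m(\partial^L_1(G))=n-4$ and $\partial^L_{n-1}(G)=n$ with multiplicity $2$ (i.e. $n$ is a distance Laplacian eigenvalue of $G$ of multiplicity exactly $2$) if and only if one of the following holds: - $G\cong SK_{n,n-2}+e$; - $G\cong SK_{n,n-3}-e$, where $e$ is an edge joining two of the three vertices of degree $n-1$ (equivalently, $G\cong K_{n-3,2,1}$); - $G\cong K_{p,p,1}+e$, where $p=\frac{n-1}{2}$ is an integer with $p\geq 3$; - $G\cong K_{p,p,2}$, where $p=\frac{n-2}{2}$ is an integer with $p\geq 3$; - $G\cong K_{p,p,p}+e$, where $p=\frac{n}{3}$ is an integer with $p\geq 3$.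
   Context: All graphs are simple and connected unless they arise as complements. For a connected graph $G$ on vertices $v_1,\dots,v_n$, let $d_{uv}$ be the length of a shortest path between $u$ and $v$, $D(G)=(d_{uv})$ the distance matrix, and $Tr_i=\sum_{u} d_{u v_i}$ the transmission of $v_i$. The distance Laplacian matrix is $D^L(G)=\mathrm{Diag}(Tr_1,\dots,Tr_n)-D(G)$; it is real symmetric positive semidefinite, and its eigenvalues (distance Laplacian eigenvalues), listed with multiplicity, are $\partial^L_1(G)\geq \partial^L_2(G)\geq\dots\geq\partial^L_{n-1}(G)>\partial^L_n(G)=0$. $m(\partial^L_i(G))$ denotes the multiplicity of $\partial^L_i(G)$ as an eigenvalue of $D^L(G)$. $K_m$ is the complete graph on $m$ vertices. $K_{t_1,\dots,t_l}$ is the complete multipartite graph with $l$ partite classes of sizes $t_1,\dots,t_l$. $SK_{n,\alpha}$ (complete split graph) is the complement of the disjoint union of a clique $K_\alpha$ and $n-\alpha$ isolated vertices. For a non-complete graph $H$, $H+e$ is the graph obtained from $H$ by adding an edge $e$ between two non-adjacent vertices (in the cases used here the result is unique up to isomorphism). For an edge $f$ of $H$, $H-f$ is the graph obtained by deleting $f$. *)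

(* Defs.v *)
From HB Require Import structures.
From mathcomp Require Import all_boot all_order all_algebra.
From mathcomp Require Import reals polyrcf.
Set Implicit Arguments.
Unset Strict Implicit.
Unset Printing Implicit Defensive.
Import Order.TTheory GRing.Theory Num.Theory.

(* Graphs are adjacency relations on a finite type of vertices; a simple graph
   is a symmetric irreflexive one. *)
Section Graphs.
Implicit Types T U : finType.

Definition simple_graph T (G : rel T) : Prop := symmetric G /\ irreflexive G.

Definition connected_graph T (G : rel T) : Prop := forall u v, connect G u v.

Definition has_path_of_length T (G : rel T) (u v : T) (k : nat) : bool :=
  [exists p : k.-tuple T, [&& path G u p, last u p == v & uniq (u :: p)]].

(* The least k < #|T| such that a path of length k joins u to v. A path has
   fewer than #|T| edges, so the bound is harmless; the junk value #|T| is
   taken only when u and v are not connected. *)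
Definition dist T (G : rel T) (u v : T) : nat :=
  find (has_path_of_length G u v) (iota 0 #|T|).

Definition transmission T (G : rel T) (v : T) : nat := \sum_(u : T) dist G u v.

Definition degree T (G : rel T) (v : T) : nat := #|[pred u | G v u]|.

Definition graph_iso T U (G : rel T) (H : rel U) : Prop :=
  exists2 f : T -> U, bijective f & forall x y, H (f x) (f y) = G x y.

Definition complement T (G : rel T) : rel T :=
  [rel x y | (x != y) && ~~ G x y].

Definition disjoint_union T U (G : rel T) (H : rel U) : rel (T + U)%type :=
  fun x y => match x, y with
    | inl a, inl b => G a b
    | inr a, inr b => H a b
    | _, _ => false
  end.

Definition complete_graph m : rel 'I_m := [rel x y | x != y].

Definition empty_graph m : rel 'I_m := [rel _ _ | false].

(* A vertex of K_{t_1,...,t_l} is a pair of a class i and an element of a set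
   of size t_i. *)
Definition multipartite_vertex (t : seq nat) : finType :=
  {i : 'I_(size t) & 'I_(nth 0 t i)}.

Definition complete_multipartite (t : seq nat) : rel (multipartite_vertex t) :=
  [rel x y | tag x != tag y].

Definition complete_split (n a : nat) : rel ('I_a + 'I_(n - a))%type :=
  complement (disjoint_union (@complete_graph a) (@empty_graph (n - a))).

Definition same_edge T (a b : T) : rel T :=
  [rel x y | ((x == a) && (y == b)) || ((x == b) && (y == a))].

Definition add_edge T (H : rel T) (a b : T) : rel T :=
  [rel x y | H x y || same_edge a b x y].

Definition del_edge T (H : rel T) (a b : T) : rel T :=
  [rel x y | H x y && ~~ same_edge a b x y].

(* H + e is not a single graph, so "G is isomorphic to H + e" is stated with an
   existential over e. *)
Definition iso_add_edge T U (G : rel T) (H : rel U) : Prop :=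
  exists a b : U, [/\ a != b, ~~ H a b & graph_iso G (add_edge H a b)].

End Graphs.

Section Spectra.
Local Open Scope ring_scope.
Variables (R : rcfType) (n : nat).

Definition multiplicity (A : 'M[R]_n) (a : R) : nat := \rank (eigenspace A a).

(* The eigenvalues of A in decreasing order, each repeated according to its
   multiplicity; rootsR lists the distinct roots in increasing order. *)
Definition spectrum (A : 'M[R]_n) : seq R :=
  flatten [seq nseq (multiplicity A a) a | a <- rev (rootsR (char_poly A))].

Definition distance_matrix (G : rel 'I_n) : 'M[R]_n :=
  \matrix_(i, j) (dist G i j)%:R.

Definition distance_laplacian (G : rel 'I_n) : 'M[R]_n :=
  diag_mx (\row_i (transmission G i)%:R) - distance_matrix G.

(* Indexed from 1; sequences are indexed from 0. *)
Definition dl_eigenvalue (G : rel 'I_n) (i : nat) : R :=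
  (spectrum (distance_laplacian G))`_i.-1.

Definition dl_multiplicity (G : rel 'I_n) (a : R) : nat :=
  multiplicity (distance_laplacian G) a.

End Spectra.

(* Main.v *)
Require Import Defs.
From HB Require Import structures.
From mathcomp Require Import all_boot all_order all_algebra.
From mathcomp Require Import reals polyrcf.
From mathcomp Require Import fingroup perm.
From mathcomp Require Import zify ring lra.
Set Implicit Arguments.
Unset Strict Implicit.
Unset Printing Implicit Defensive.
Import Order.TTheory GRing.Theory Num.Theory.

(** The distance Laplacian [M] is the Laplacian of the complete graph with
    weights [d x y], that is, [(v M) y] is the sum over [x] of
    [d x y * (v y - v x)]. Since all weights are at least one, and at least two
    on the edges of the complement, comparing quadratic forms shows that an
    eigenvector for [n] is constant on every component of the complement
    ([eigenvector_order_const]). Conversely, when the complement has [k > 1]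
    components, every vector of sum zero that is constant on them is an
    eigenvector for [n]. So [n] has multiplicity [k - 1]
    ([multiplicity_order]): multiplicity 3 means four components, and
    multiplicity 2 means three.

    Once the complement is disconnected, all distances are at most two, and on
    the vectors of sum zero [M] is [n] plus the Laplacian [L] of the complement.
    Let [theta] be the largest eigenvalue, [mu = theta - n], and let [P] be the
    orthogonal projection onto the vectors constant on components. The symmetric
    matrix [S = mu (1 - P) - L], called the defect below, kills the image of [P]
    and the eigenspace of [theta], so a dimension count ([rank_defect]) bounds its
    rank by 0 in the first case and by 1 in the second.

    If [S = 0], the entries of [L = mu (1 - P)] force each component of the
    complement to be complete of size 1 or [mu] ([defect0_multipartite]). If
    [S = s w^T w] has rank one, then [s > 0] because [theta] is the largest
    eigenvalue, and [w] lives on a single component, where the sign of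
    [w x * w y] is known for all pairs. This forces that component to be an edge,
    or complete of size [mu] with one edge deleted, and all others to be complete
    of size 1 or [mu] ([defect_rank1_shape]).

    In the other direction, explicit eigenvectors bound the multiplicities of
    the expected eigenvalues from below. These bounds add up to [n], so they are
    exact and the list of eigenvalues is determined ([spectrum_certificate]).

    Both directions speak of a map that sends vertices to classes and of the
    sizes of its fibers. Graphs given in this way are isomorphic as soon as the
    class sizes agree up to order ([fiber_bijection], [reorder_classes]), and the
    listed graphs are what remains when four or three sizes add up to [n]. *)

(** * Eigenvalues with multiplicity *)

Section SpectrumOfAMatrix.
Local Open Scope ring_scope.
Variables (R : rcfType) (n : nat).
Implicit Types (A : 'M[R]_n) (a : R).

Let gt_trans : transitive (>%R : rel R).
Proof. by move=> y x z /= lyx lzy; apply: lt_trans lyx. Qed.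

Lemma mem_rootsR_char_poly A a :
  (a \in rootsR (char_poly A)) = (0 < multiplicity A a)%N.
Proof.
have nz : char_poly A != 0 by rewrite monic_neq0 ?char_poly_monic.
have := roots_on_rootsR nz a; rewrite in_itv /= => <-.
by rewrite -eigenvalue_root_char /eigenvalue /multiplicity lt0n mxrank_eq0.
Qed.

Lemma rev_rootsR_sorted (p : {poly R}) : sorted >%R (rev (rootsR p)).
Proof. by rewrite rev_sorted; apply: sorted_roots. Qed.

Lemma sum_multiplicity_le A (s : seq R) :
  uniq s -> (\sum_(a <- s) multiplicity A a <= n)%N.
Proof.
move=> us; rewrite (big_nth 0) big_mkord.
have inj_s : {in predT &, injective (fun i : 'I_(size s) => s`_i)}.
  move=> i j _ _ eij.
  by apply/val_inj/eqP; rewrite -(nth_uniq 0 (ltn_ord i) (ltn_ord j) us); apply/eqP.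
have /mxdirectP /= := mxdirect_sum_eigenspace A inj_s.
rewrite /multiplicity => <-.
exact: rank_leq_col.
Qed.

(** Eigenspaces of distinct eigenvalues are independent, so their dimensions
    add up to at most the order of the matrix; lower bounds on these dimensions
    that already exhaust the order are therefore equalities and leave no room
    for another eigenvalue. *)
Lemma spectrum_certificate A (s : seq (R * nat)) :
    sorted >%R (unzip1 s) ->
    {in s, forall u, (0 < u.2 <= multiplicity A u.1)%N} ->
    (\sum_(u <- s) u.2)%N = n ->
  spectrum A = flatten [seq nseq u.2 u.1 | u <- s]
  /\ {in s, forall u, multiplicity A u.1 = u.2}.
Proof.
move=> ss hs sum_n.
have us : uniq (unzip1 s) by apply: (sorted_uniq gt_trans (@ltxx _ _)) ss.
have mE : {in s, forall u, multiplicity A u.1 = u.2}.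
  have := sum_multiplicity_le A us; rewrite big_map.
  rewrite -[X in (_ <= X)%N]sum_n => le_sum u us'.
  apply/eqP; rewrite eqn_leq andbC; case/andP: (hs u us') => _ -> /=.
  move: le_sum; rewrite !(big_rem u us') /= leqNgt; apply: contraTT.
  rewrite -ltnNge negbK => lt_u; rewrite -addSn leq_add //.
  rewrite !big_seq leq_sum // => v /mem_rem vs.
  by case/andP: (hs v vs).
split=> //; rewrite /spectrum.
suff -> : rev (rootsR (char_poly A)) = unzip1 s.
  rewrite -map_comp; congr flatten; apply/eq_in_map => u us' /=.
  by rewrite mE.
apply: (irr_sorted_eq gt_trans (@ltxx _ _)); rewrite ?rev_rootsR_sorted // => a.
rewrite mem_rev mem_rootsR_char_poly; apply/idP/idP => [ma|].
  apply/negPn/negP => na.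
  have := @sum_multiplicity_le A (a :: unzip1 s).
  rewrite /= na us big_cons big_map => /(_ isT).
  rewrite -[X in (_ <= X)%N]sum_n leqNgt => /negP; apply.
  rewrite -[X in (X < _)%N]add0n -addSn leq_add // !big_seq leq_sum // => v /hs.
  by case/andP.
by case/mapP => u us' ->; case/andP: (hs u us') => h1 h2; apply: leq_trans h2.
Qed.

Lemma spectrum_head A (theta := (spectrum A)`_0) : spectrum A != [::] ->
  [/\ (0 < multiplicity A theta)%N,
      forall a, (0 < multiplicity A a)%N -> a <= theta
    & exists2 s, spectrum A = nseq (multiplicity A theta) theta ++ s
      & {in s, forall b, b < theta}].
Proof.
rewrite /theta /spectrum.
have := rev_rootsR_sorted (char_poly A).
have := mem_rootsR_char_poly A.
move: (rootsR _) => r0; rewrite -[r0]revK; move: (rev r0) => {r0} r; rewrite revK.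
case: r => [|x r] //= rE; rewrite (path_sortedE gt_trans) => /andP[/allP lt_x _].
have mx : (0 < multiplicity A x)%N by rewrite -rE mem_rev mem_head.
case mE: (multiplicity A x) mx => [//|k] _ _ /=; rewrite mE; split=> //.
  by move=> a; rewrite -rE mem_rev inE => /predU1P[->//|/lt_x/ltW].
exists (flatten [seq nseq (multiplicity A a) a | a <- r]) => // b.
by move=> /flatten_mapP[a /lt_x ax]; rewrite mem_nseq => /andP[_ /eqP->].
Qed.

End SpectrumOfAMatrix.

(** * Distances at most two *)

Section Distances.
Variables (T : finType) (G : rel T).
Implicit Types u v w : T.

Lemma dist_leq u v k : has_path_of_length G u v k -> dist G u v <= k.
Proof.
move=> uv; rewrite leqNgt; apply/negP => /[dup] lt_k /(before_find 0).
suff lt_kT : k < #|T| by rewrite nth_iota // uv.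
case/existsP: uv => p /and3P[_ _ /card_uniqP up].
by have := max_card (mem (u :: p)); rewrite up /= size_tuple.
Qed.

Lemma has_path_dist u v : dist G u v < #|T| -> has_path_of_length G u v (dist G u v).
Proof.
move=> lt_d; have : has (has_path_of_length G u v) (iota 0 #|T|).
  by rewrite has_find size_iota.
by move/(nth_find 0); rewrite nth_iota.
Qed.

Lemma has_path0 u v : has_path_of_length G u v 0 -> u = v.
Proof. by case/existsP=> p; rewrite tuple0 /= => /andP[/eqP]. Qed.

Lemma has_path1 u v : has_path_of_length G u v 1 -> G u v.
Proof.
case/existsP=> p; case/tupleP: p => w p; rewrite tuple0 /= andbT.
by case/andP=> Guw /andP[/eqP<-].
Qed.

Lemma card_gt1_neq u v : u != v -> 1 < #|T|.
Proof.
move=> nuv; rewrite (leq_trans _ (max_card (mem [:: u; v]))) //.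
by rewrite (card_uniqP _) //= inE nuv.
Qed.

Lemma dist_gt0 u v : u != v -> 0 < dist G u v.
Proof.
move=> nuv; rewrite lt0n; apply: contra nuv => /eqP d0.
have := @has_path_dist u v; rewrite d0 => /(_ _)/has_path0 -> //.
by apply/card_gt0P; exists u.
Qed.

Lemma dist_adj u v : u != v -> G u v -> dist G u v = 1.
Proof.
move=> nuv Guv; apply/eqP; rewrite eqn_leq dist_gt0 // andbT dist_leq //.
by apply/existsP; exists [tuple v]; rewrite /= Guv eqxx inE nuv.
Qed.

Lemma dist_nadj_gt1 u v : u != v -> ~~ G u v -> 1 < dist G u v.
Proof.
move=> nuv nG; rewrite ltn_neqAle dist_gt0 // andbT.
apply: contra nG => /eqP d1; have := @has_path_dist u v.
by rewrite -d1 => /(_ (card_gt1_neq nuv))/has_path1.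
Qed.

Lemma dist_nadj u v w : u != v -> ~~ G u v -> u != w -> w != v ->
  G u w -> G w v -> dist G u v = 2.
Proof.
move=> nuv nG nuw nwv Guw Gwv; apply/eqP; rewrite eqn_leq dist_nadj_gt1 // andbT.
apply: dist_leq; apply/existsP; exists [tuple w; v].
by rewrite /= Guw Gwv eqxx !inE negb_or nuv nuw nwv.
Qed.

Lemma has_path_sym u v k : symmetric G ->
  has_path_of_length G u v k -> has_path_of_length G v u k.
Proof.
move=> symG /existsP[p /and3P[Gp /eqP lp up]]; apply/existsP.
have sz : size (rev (belast u p)) == k by rewrite size_rev size_belast size_tuple.
exists (Tuple sz) => /=; rewrite -lp rev_path.
rewrite (eq_path (e' := G)) ?Gp /=; last by move=> x y; rewrite symG.
have -> : last (last u p) (rev (belast u p)) = u.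
  by case: (tval p) => //= x q; rewrite rev_cons last_rcons.
rewrite eqxx /=; move: up; rewrite [in X in X -> _]lastI rcons_uniq.
by rewrite mem_rev rev_uniq.
Qed.

Lemma dist_sym u v : symmetric G -> dist G u v = dist G v u.
Proof.
move=> symG; apply: eq_find => k.
by apply/idP/idP; apply: has_path_sym.
Qed.

End Distances.

(** * The quadratic form of the distance Laplacian *)

Section DistanceLaplacian.
Local Open Scope ring_scope.
Variables (R : realType) (n : nat) (G : rel 'I_n).
Hypothesis symG : symmetric G.
Local Notation M := (distance_laplacian R G).
Local Notation d := (fun x y => (dist G x y)%:R : R).
Implicit Types v w : 'rV[R]_n.

Lemma distance_laplacian_offdiag x y : x != y -> M x y = - d x y.
Proof. by move=> nxy; rewrite !mxE (negPf nxy) mulr0n sub0r. Qed.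

Lemma distance_laplacian_tr : M^T = M.
Proof.
rewrite /distance_laplacian linearB /= tr_diag_mx; congr (_ - _).
by apply/matrixP => x y; rewrite !mxE dist_sym.
Qed.

(** Only differences of entries matter, so the distances between vertices where
    [v] agrees drop out of all later computations. *)
Lemma mul_distance_laplacian v y :
  (v *m M) 0 y = \sum_x d x y * (v 0 y - v 0 x).
Proof.
rewrite /distance_laplacian mulmxBr mxE mul_mx_diag !mxE /transmission natr_sum.
rewrite mulr_sumr -sumrB; apply: eq_bigr => x _.
by rewrite !mxE; ring.
Qed.

Lemma const_distance_laplacian : const_mx 1 *m M = 0 :> 'rV[R]_n.
Proof.
apply/rowP => y; rewrite mul_distance_laplacian !mxE big1 // => x _.
by rewrite !mxE subrr mulr0.
Qed.

(** [M] is symmetric and kills the constant vectors, so its other eigenvectors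
    are orthogonal to them. *)
Lemma eigenvector_sum0 v a : v *m M = a *: v -> a != 0 -> \sum_x v 0 x = 0.
Proof.
move=> vM a0; have : v *m M *m (const_mx 1 : 'cV_n) = 0.
  rewrite -mulmxA -[M]trmxK -[const_mx 1]trmxK -trmx_mul.
  by rewrite distance_laplacian_tr trmx_const const_distance_laplacian trmx0 mulmx0.
rewrite vM -scalemxAl => /matrixP/(_ 0 0); rewrite !mxE.
under eq_bigr do rewrite mxE mulr1.
by move/eqP; rewrite mulf_eq0 (negPf a0) => /eqP.
Qed.

Lemma distance_laplacian_form v :
  \sum_x \sum_y d x y * (v 0 y - v 0 x) ^+ 2
  = 2 * \sum_y (v *m M) 0 y * v 0 y.
Proof.
have h : \sum_y (v *m M) 0 y * v 0 y
       = \sum_x \sum_y d x y * (v 0 y - v 0 x) * v 0 y.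
  rewrite exchange_big /=; apply: eq_bigr => y _.
  by rewrite mul_distance_laplacian mulr_suml.
have h' : \sum_y (v *m M) 0 y * v 0 y
        = \sum_x \sum_y d x y * (v 0 x - v 0 y) * v 0 x.
  rewrite h exchange_big /=; apply: eq_bigr => x _; apply: eq_bigr => y _.
  by rewrite dist_sym.
rewrite mulr_natl mulr2n {1}h h' -big_split /=.
apply: eq_bigr => x _; rewrite -big_split /=; apply: eq_bigr => y _; ring.
Qed.

(** For a vector orthogonal to the constants the form of [M] minus [n] times
    the squared norm is the sum of [(d x y - 1) * (v y - v x) ^+ 2], all of
    whose terms are nonnegative. *)
Lemma eigenvector_order_const v x y : v *m M = n%:R *: v ->
  x != y -> ~~ G x y -> v 0 x = v 0 y.
Proof.
move=> vM nxy nG.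
have n0 : n%:R != 0 :> R by rewrite pnatr_eq0; move: x {nxy nG}; case: (n) => [[]|].
have sv := eigenvector_sum0 vM n0.
have sum0 : \sum_x \sum_y (d x y - 1) * (v 0 y - v 0 x) ^+ 2 = 0.
  have e2 : \sum_x \sum_y (v 0 y - v 0 x) ^+ 2 = 2 * (n%:R * \sum_x v 0 x ^+ 2).
    have e1 z : \sum_y (v 0 y - v 0 z) ^+ 2
              = \sum_y v 0 y ^+ 2 + n%:R * v 0 z ^+ 2.
      under eq_bigr => t _ do rewrite sqrrB addrAC -mulrnAl.
      by rewrite sumrB big_split /= sumr_const card_ord mulr_natl -mulr_suml
        sumrMnl sv mul0rn mul0r subr0.
    rewrite (eq_bigr _ (fun z _ => e1 z)) big_split /= sumr_const card_ord.
    by rewrite -mulr_sumr -[_ *+ n]mulr_natl; ring.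
  transitivity (\sum_x (\sum_y d x y * (v 0 y - v 0 x) ^+ 2
                        - \sum_y (v 0 y - v 0 x) ^+ 2)).
    by apply: eq_bigr => z _; rewrite -sumrB; apply: eq_bigr => t _; ring.
  rewrite sumrB distance_laplacian_form e2 vM; apply/eqP; rewrite subr_eq0.
  apply/eqP; congr (_ * _); rewrite mulr_sumr; apply: eq_bigr => t _.
  by rewrite mxE; ring.
have ge0 z t : 0 <= (d z t - 1) * (v 0 t - v 0 z) ^+ 2.
  have [->|nzt] := eqVneq z t; first by rewrite subrr expr0n mulr0.
  apply: mulr_ge0; last exact: sqr_ge0.
  by have := dist_gt0 G nzt; rewrite -(ler_nat R); lra.
have sx0 : \sum_t (d x t - 1) * (v 0 t - v 0 x) ^+ 2 = 0.
  exact: psumr_eq0P (fun z _ => sumr_ge0 _ (fun t _ => ge0 z t)) sum0 _ _.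
have /eqP : (d x y - 1) * (v 0 y - v 0 x) ^+ 2 = 0.
  exact: psumr_eq0P (fun t _ => ge0 x t) sx0 _ _.
have := dist_nadj_gt1 nxy nG; rewrite -(ler_nat R) => d2.
by rewrite mulf_eq0 sqrf_eq0 !subr_eq0 => /orP[/eqP|/eqP->//]; lra.
Qed.

End DistanceLaplacian.

(** * Lower bounds for multiplicities *)

Definition fiber_size (T I : finType) (c : T -> I) (i : I) : nat :=
  #|[pred x | c x == i]|.

Section Multiplicities.
Local Open Scope ring_scope.
Variables (R : realType) (n : nat).
Implicit Types v : 'rV[R]_n.

Lemma sum_delta (T : finType) (a : T) (F : T -> R) :
  \sum_x (x == a)%:R * F x = F a.
Proof.
rewrite (bigD1 a) //= eqxx mul1r big1 ?addr0 // => x /negPf->.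
by rewrite mul0r.
Qed.

Lemma multiplicity_gt0 (A : 'M[R]_n) a v :
  v != 0 -> v *m A = a *: v -> (0 < multiplicity A a)%N.
Proof.
move=> v0 vA; rewrite lt0n mxrank_eq0; apply/eigenvalueP; by exists v.
Qed.

(** The solutions of [r] linear equations form a space of codimension at most
    [r]. *)
Lemma multiplicity_ge_constraints (A : 'M[R]_n) a r (B : 'M_(n, r)) :
  (forall v, v *m B = 0 -> v *m A = a *: v) -> (n - r <= multiplicity A a)%N.
Proof.
move=> h; apply: (@leq_trans (\rank (kermx B))).
  by rewrite mxrank_ker leq_sub2l // rank_leq_col.
apply: mxrankS; apply/row_subP => i; apply/eigenspaceP; apply: h.
by rewrite -row_mul mulmx_ker row0.
Qed.

Variables (k : nat) (c : 'I_n -> 'I_k).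

Definition class_indicator : 'M[R]_(k, n) := \matrix_(i, x) (c x == i)%:R.
Local Notation E := class_indicator.

Lemma mul_class_indicator (w : 'rV_k) x : (w *m E) 0 x = w 0 (c x).
Proof.
rewrite mxE -[RHS](sum_delta (c x)); apply: eq_bigr => i _.
by rewrite mxE mulrC eq_sym.
Qed.

Lemma mul_class_indicator_tr v i :
  (v *m E^T) 0 i = \sum_(x | c x == i) v 0 x.
Proof.
rewrite mxE [RHS]big_mkcond; apply: eq_bigr => x _.
by rewrite !mxE; case: eqP => _; rewrite ?mulr1 ?mulr0.
Qed.

Hypothesis surj_c : forall i, exists x, c x = i.

Lemma class_indicator_free : row_free E.
Proof.
apply: inj_row_free => w wE; apply/rowP => i; have [x <-] := surj_c i.
by rewrite -mul_class_indicator wE !mxE.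
Qed.

Variable G : rel 'I_n.
Hypothesis multipartite_sub : forall x y, c x != c y -> G x y.
Local Notation M := (distance_laplacian R G).

Lemma dist_distinct_classes x y : c x != c y -> dist G x y = 1%N.
Proof.
move=> nc; apply: dist_adj; last exact: multipartite_sub.
by apply: contraNN nc => /eqP->.
Qed.

(** Any vertex of another class is a common neighbour. *)
Lemma dist_same_class x y :
  (1 < k)%N -> x != y -> c x = c y -> ~~ G x y -> dist G x y = 2%N.
Proof.
move=> k_gt1 nxy cxy nG; have [i ni] : exists i, i != c x.
  have : (0 < #|predC1 (c x)|)%N by rewrite cardC1 card_ord; lia.
  by case/card_gt0P => i ni; exists i.
have [z zi] := surj_c i; rewrite -zi in ni.
have nzx : z != x by apply: contraNN ni => /eqP->.
have nzy : z != y by apply: contraNN ni => /eqP->; rewrite cxy.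
rewrite (@dist_nadj _ _ _ _ z) // 1?eq_sym //; apply: multipartite_sub => //.
  by rewrite eq_sym.
by rewrite -cxy.
Qed.

(** Vertices in distinct classes are at distance one, so the distances inside
    the classes do not affect a vector that is constant on each of them. *)
Lemma mul_class_constant v y : (forall x z, c x = c z -> v 0 x = v 0 z) ->
  (v *m M) 0 y = n%:R * v 0 y - \sum_x v 0 x.
Proof.
move=> vc; rewrite mul_distance_laplacian.
have -> : n%:R * v 0 y = \sum_(x < n) v 0 y.
  by rewrite sumr_const card_ord mulr_natl.
rewrite -sumrB; apply: eq_bigr => x _.
have [cxy|nc] := eqVneq (c x) (c y); first by rewrite (vc _ _ cxy) subrr mulr0.
by rewrite dist_distinct_classes // mul1r.
Qed.

Lemma multiplicity_order_ge : (k <= (multiplicity M n%:R).+1)%N.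
Proof.
pose s : 'cV[R]_k := E *m const_mx 1.
have le_k : (k - 1 <= \rank (kermx s *m E))%N.
  by rewrite mxrankMfree ?class_indicator_free // mxrank_ker leq_sub2l // rank_leq_col.
suff : (k - 1 <= multiplicity M n%:R)%N by lia.
apply: leq_trans le_k _; apply: mxrankS; apply/row_subP => i.
apply/eigenspaceP; rewrite row_mul; set w := row i _.
have /matrixP/(_ 0 0) : w *m s = 0 by rewrite -row_mul mulmx_ker row0.
rewrite /s mulmxA [LHS]mxE [RHS]mxE => sum0.
apply/rowP => y; rewrite mul_class_constant; last first.
  by move=> x z cxz; rewrite !mul_class_indicator cxz.
rewrite [RHS]mxE -[RHS]subr0 -[X in _ = _ - X]sum0; congr (_ - _).
by apply: eq_bigr => x _; rewrite [const_mx 1 _ _]mxE mulr1.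
Qed.

Variables (e : bool) (a b : 'I_n).
Hypothesis GE : forall x y, G x y = (c x != c y) || e && same_edge a b x y.
Hypothesis k_gt1 : (1 < k)%N.
Hypothesis edge_ab : e -> a != b /\ c a = c b.

Lemma dist_near_multipartite x y : x != y ->
  (dist G x y + e && same_edge a b x y = 1 + (c x == c y))%N.
Proof.
move=> nxy; have [cxy|nc] := eqVneq (c x) (c y); last first.
  rewrite dist_distinct_classes // /same_edge /=; case: {+}e edge_ab => //= -[//|_ cab].
  by case: andP => [[/eqP xa /eqP yb]|_]; [|case: andP => [[/eqP xb /eqP ya]|//]];
    move: nc; rewrite ?xa ?xb ?ya ?yb cab eqxx.
case eE: (e && _); first by rewrite dist_adj // GE eE orbT.
by rewrite dist_same_class // GE eE cxy eqxx.
Qed.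

(** Writing [d x y] as [1 + (c x == c y)], minus one on the added edge, splits
    the action into those of a complete graph, of disjoint complete graphs
    on the classes, and of the single edge [a b]. *)
Lemma mul_near_multipartite v y :
  (v *m M) 0 y = n%:R * v 0 y - \sum_x v 0 x
     + ((fiber_size c (c y))%:R * v 0 y - \sum_(x | c x == c y) v 0 x)
     - e%:R * ((y == a)%:R - (y == b)%:R) * (v 0 a - v 0 b).
Proof.
rewrite mul_distance_laplacian.
transitivity (\sum_x (v 0 y - v 0 x) + \sum_(x | c x == c y) (v 0 y - v 0 x)
   - \sum_x (e && same_edge a b x y)%:R * (v 0 y - v 0 x)).
  rewrite [X in _ + X - _]big_mkcond -big_split -sumrB /=; apply: eq_bigr => x _.
  have [->|nxy] := eqVneq x y; first by rewrite subrr !mulr0; case: ifP; rewrite !addr0 subr0.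
  have /(congr1 (fun m => m%:R : R)) := dist_near_multipartite nxy.
  rewrite !natrD => dE.
  rewrite -[(dist _ _ _)%:R](addrK (e && same_edge a b x y)%:R) dE.
  case: (c x == c y) => /=; ring.
congr (_ + _ - _).
- by rewrite sumrB sumr_const card_ord mulr_natl.
- by rewrite sumrB sumr_const mulr_natl.
case: e edge_ab => [[//|nab _]|_] /=; last first.
  by rewrite !mul0r big1 // => x _; rewrite mul0r.
transitivity (\sum_x (x == a)%:R * ((y == b)%:R * (v 0 y - v 0 x))
            + \sum_x (x == b)%:R * ((y == a)%:R * (v 0 y - v 0 x))).
  rewrite -big_split; apply: eq_bigr => x _ /=.
  have -> : same_edge a b x y = ((x == a) && (y == b)) || ((x == b) && (y == a)) by [].
  have [->|_] := eqVneq x a; last by rewrite /= !mul0r add0r mulrA -natrM mulnb.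
  by rewrite (negPf nab) /= orbF !mul0r addr0 mul1r.
rewrite !sum_delta.
have [->|_] := eqVneq y a; first by rewrite (negPf nab) /=; ring.
by have [->|_] := eqVneq y b; rewrite /=; ring.
Qed.

End Multiplicities.

(** * Spectra of multipartite graphs and of their extensions by an edge *)

Lemma pair_of_card2 (T : finType) (P : pred T) a b z :
  #|P| = 2 -> a != b -> P a -> P b -> P z -> z = a \/ z = b.
Proof.
move=> card2 nab Pa Pb Pz.
have [->|nza] := eqVneq z a; first by left.
have [->|nzb] := eqVneq z b; first by right.
have us : uniq [:: z; a; b] by rewrite /= !inE negb_or nza nzb nab.
have : #|[:: z; a; b]| <= #|P|.
  by apply/subset_leq_card/subsetP => t; rewrite !inE => /or3P[]/eqP->.
by rewrite (card_uniqP us) card2.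
Qed.

Section Spectra.
Local Open Scope ring_scope.
Variables (R : realType) (n k : nat) (G : rel 'I_n) (c : 'I_n -> 'I_k).
Hypothesis surj_c : forall i, exists x, c x = i.
Hypothesis k_gt1 : (1 < k)%N.
Local Notation M := (distance_laplacian R G).
Implicit Types v : 'rV[R]_n.

Lemma sum_classes v :
  v *m (class_indicator R c)^T = 0 -> forall y, \sum_(x | c x == c y) v 0 x = 0.
Proof. by move=> vE y; rewrite -mul_class_indicator_tr vE mxE. Qed.

Lemma sum_all_classes v :
  v *m (class_indicator R c)^T = 0 -> \sum_x v 0 x = 0.
Proof.
move=> vE; rewrite (partition_big c predT) //= big1 // => i _.
by rewrite -mul_class_indicator_tr vE mxE.
Qed.

Lemma fiber_size_gt0 y : (0 < fiber_size c (c y))%N.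
Proof. by apply/card_gt0P; exists y; rewrite inE. Qed.

(** The sum over the class is then its size times the common value. *)
Lemma const_class_eq0 v y :
    v *m (class_indicator R c)^T = 0 ->
    (forall x, c x = c y -> v 0 x = v 0 y) ->
  v 0 y = 0.
Proof.
move=> vE vc; have := sum_classes vE y.
under eq_bigr => x /eqP cxy do rewrite vc //.
rewrite sumr_const => /eqP; rewrite mulrn_eq0 => /orP[|/eqP//].
by have := fiber_size_gt0 y; rewrite lt0n /fiber_size => /negPf->.
Qed.

Lemma singleton_class y x : fiber_size c (c y) = 1%N -> c x = c y -> x = y.
Proof.
move=> s1 cxy; have /card_le1_eqP : (#|[pred z | c z == c y]| <= 1)%N by rewrite -s1.
by apply; rewrite inE ?cxy.
Qed.

Lemma classes_leq_order : (k <= n)%N.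
Proof.
have := class_indicator_free R surj_c; rewrite /row_free => /eqP <-.
exact: rank_leq_col.
Qed.

Let n_gt0 : (0 < n)%N.
Proof. by apply: leq_trans classes_leq_order; apply: ltnW. Qed.

Let multiplicity0 : (0 < multiplicity M 0)%N.
Proof.
apply: (@multiplicity_gt0 _ _ _ _ (const_mx 1)).
  by apply/eqP => /rowP/(_ (Ordinal n_gt0))/eqP; rewrite !mxE oner_eq0.
by rewrite const_distance_laplacian scale0r.
Qed.

(** A vector whose sum over each class vanishes is an eigenvector for [n + p]: it
    is zero on the classes of size one, and on those of size [p] the complete
    graph acts by [p]. *)
Lemma multipartite_spectrum p :
    (forall x y, G x y = (c x != c y)) ->
    (forall i, fiber_size c i = 1%N \/ fiber_size c i = p) ->
    (k < n)%N -> (1 < p)%N ->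
  [/\ dl_multiplicity G (dl_eigenvalue R G 1) = (n - k)%N,
      dl_eigenvalue R G (n - 1) = n%:R
    & dl_multiplicity G (n%:R : R) = (k - 1)%N].
Proof.
move=> GE sizes k_lt_n p_gt1.
have mp_sub x y : c x != c y -> G x y by rewrite GE.
have GE' a x y : G x y = (c x != c y) || false && same_edge a a x y.
  by rewrite GE orbF.
have top : (n - k <= multiplicity M (n + p)%:R)%N.
  apply: (@multiplicity_ge_constraints _ _ _ _ _ (class_indicator R c)^T) => v vE.
  apply/rowP => y; rewrite [RHS]mxE.
  have noedge : false -> y != y /\ c y = c y by [].
  rewrite (mul_near_multipartite surj_c mp_sub (GE' y) k_gt1 noedge).
  rewrite (sum_classes vE) (sum_all_classes vE) !mul0r !subr0.
  have [s1|->] := sizes (c y); last by rewrite natrD mulrDl.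
  rewrite (const_class_eq0 vE) ?mulr0 ?addr0 // => x cxy.
  by rewrite (singleton_class s1 cxy).
have ordn : (k - 1 <= multiplicity M n%:R)%N.
  by rewrite leq_subLR add1n; apply: multiplicity_order_ge.
pose s : seq (R * nat) :=
  [:: ((n + p)%:R, (n - k)%N); (n%:R, (k - 1)%N); (0, 1%N)].
have [] := @spectrum_certificate _ _ M s.
- by rewrite /= !ltr_nat ltr0n n_gt0 andbT; lia.
- move=> u; rewrite !inE => /or3P[]/eqP-> /=.
  + by rewrite top andbT; lia.
  + by rewrite ordn andbT; lia.
  + exact: multiplicity0.
- by rewrite !big_cons big_nil /=; lia.
move=> specE multE.
have e1 : dl_eigenvalue R G 1 = (n + p)%:R.
  by rewrite /dl_eigenvalue specE /= nth_cat size_nseq subn_gt0 k_lt_n nth_nseq subn_gt0 k_lt_n.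
split.
- by rewrite e1; apply: (multE ((n + p)%:R, (n - k)%N)); rewrite !inE eqxx.
- rewrite /dl_eigenvalue specE /= nth_cat size_nseq.
  have -> : ((n - 1).-1 < n - k)%N = false by lia.
  rewrite nth_cat size_nseq nth_nseq.
  by have -> : ((n - 1).-1 - (n - k) < k - 1)%N by lia.
- by apply: (multE (n%:R, (k - 1)%N)); rewrite !inE eqxx orbT.
Qed.

(** One more equation, [v a = v b], cancels the effect of the added edge, or makes
    [v] vanish on the class [{a, b}] when [e] is false. The difference of the
    indicators of [a] and [b] is the eigenvector lost in this way; its
    eigenvalue lies strictly between [n] and [n + p]. *)
Lemma near_multipartite_spectrum p e a b :
    (forall x y, G x y = (c x != c y) || e && same_edge a b x y) ->
    a != b -> c a = c b ->
    (forall i, i != c a -> fiber_size c i = 1%N \/ fiber_size c i = p) ->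
    fiber_size c (c a) = (if e then p else 2)%N ->
    (k.+1 < n)%N -> (2 < p)%N ->
  [/\ dl_multiplicity G (dl_eigenvalue R G 1) = (n - k.+1)%N,
      dl_eigenvalue R G (n - 1) = n%:R
    & dl_multiplicity G (n%:R : R) = (k - 1)%N].
Proof.
move=> GE nab cab sizes size_a k_lt_n p_gt2.
have mp_sub x y : c x != c y -> G x y by rewrite GE => ->.
have actE := @mul_near_multipartite R _ _ c surj_c _ mp_sub e a b GE k_gt1 (fun _ => conj nab cab).
have top : (n - k.+1 <= multiplicity M (n + p)%:R)%N.
  rewrite -addn1; apply: (@multiplicity_ge_constraints _ _ _ _ _
     (row_mx (class_indicator R c)^T (delta_mx a 0 - delta_mx b 0))) => v.
  rewrite mul_mx_row -[0 in RHS]row_mx0 => /eq_row_mx[vE].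
  move/matrixP/(_ 0 0); rewrite mulmxBr -!colE !mxE => /eqP; rewrite subr_eq0 => /eqP vab.
  apply/rowP => y; rewrite [RHS]mxE actE.
  rewrite (sum_classes vE) (sum_all_classes vE) vab subrr mulr0 !subr0.
  have [ya|nya] := eqVneq (c y) (c a).
    rewrite ya size_a; case eE: e; first by rewrite natrD mulrDl.
    rewrite (const_class_eq0 vE) ?mulr0 ?addr0 // => x; rewrite ya => cxa.
    have in_ab z : c z = c a -> z = a \/ z = b.
      move=> cza; apply: (@pair_of_card2 _ [pred z | c z == c a]) => //=.
      - by move: size_a; rewrite eE.
      - by rewrite cab.
      - by rewrite cza.
    by case: (in_ab _ cxa) => ->; case: (in_ab _ ya) => ->.
  have [s1|->] := sizes _ nya; last by rewrite natrD mulrDl.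
  rewrite (const_class_eq0 vE) ?mulr0 ?addr0 // => x cxy.
  by rewrite (singleton_class s1 cxy).
pose q := (if e then p - 2 else 2)%N.
have mid : (1 <= multiplicity M (n + q)%:R)%N.
  pose v : 'rV[R]_n := delta_mx 0 a - delta_mx 0 b.
  have vE y : v 0 y = (y == a)%:R - (y == b)%:R by rewrite !mxE.
  have sumP (P : pred 'I_n) : P a = P b -> \sum_(x | P x) v 0 x = 0.
    move=> Pab; rewrite big_mkcond /=.
    transitivity (\sum_x (x == a)%:R * (P x)%:R - \sum_x (x == b)%:R * (P x)%:R : R).
      rewrite -sumrB; apply: eq_bigr => x _; rewrite vE.
      by case: (P x); rewrite ?mulr1 ?mulr0 ?subrr.
    by rewrite !(@sum_delta R _ _ (fun x => (P x)%:R)) Pab subrr.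
  apply: (@multiplicity_gt0 _ _ _ _ v).
    apply/eqP => /rowP/(_ a)/eqP.
    by rewrite vE mxE eqxx (negPf nab) subr0 oner_eq0.
  apply/rowP => y; rewrite [RHS]mxE actE !sumP ?cab // !vE !eqxx (negPf nab).
  rewrite [b == a]eq_sym (negPf nab) /=.
  have [ya|nya] := eqVneq y a; [|have [yb|nyb] := eqVneq y b].
  - rewrite ya size_a /q (negPf nab) /=; case: {+}e => /=; last by rewrite natrD; ring.
    by rewrite natrD natrB 1?ltnW //; ring.
  - rewrite yb -cab size_a /q /=; case: {+}e => /=; last by rewrite natrD; ring.
    by rewrite natrD natrB 1?ltnW //; ring.
  - by rewrite /=; ring.
have ordn : (k - 1 <= multiplicity M n%:R)%N.
  by rewrite leq_subLR add1n; apply: multiplicity_order_ge.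
pose s : seq (R * nat) :=
  [:: ((n + p)%:R, (n - k.+1)%N); ((n + q)%:R, 1%N); (n%:R, (k - 1)%N); (0, 1%N)].
have [] := @spectrum_certificate _ _ M s.
- by rewrite /= !ltr_nat ltr0n n_gt0 andbT /q; case: {+}e; lia.
- move=> u; rewrite !inE => /or4P[]/eqP-> /=.
  + by rewrite top andbT; lia.
  + exact: mid.
  + by rewrite ordn andbT; lia.
  + exact: multiplicity0.
- by rewrite !big_cons big_nil /=; lia.
move=> specE multE.
have lt_k : (0 < n - k.+1)%N by rewrite subn_gt0.
have e1 : dl_eigenvalue R G 1 = (n + p)%:R.
  by rewrite /dl_eigenvalue specE /= nth_cat size_nseq lt_k nth_nseq lt_k.
split.
- by rewrite e1; apply: (multE ((n + p)%:R, (n - k.+1)%N)); rewrite !inE eqxx.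
- rewrite /dl_eigenvalue specE /= nth_cat size_nseq.
  have -> : ((n - 1).-1 < n - k.+1)%N = false by lia.
  have -> : ((n - 1).-1 - (n - k.+1) = (k - 2).+1)%N by lia.
  rewrite /= nth_cat size_nseq nth_nseq.
  by have -> : (k - 2 < k - 1)%N by lia.
- by apply: (multE (n%:R, (k - 1)%N)); rewrite !inE eqxx !orbT.
Qed.

End Spectra.

(** * From the spectrum to the shape of the complement *)

Lemma component_map n (e : rel 'I_n) : 0 < n -> symmetric e ->
  exists k (c : 'I_n -> 'I_k), (forall i, exists x, c x = i)
    /\ forall x y, (c x == c y) = connect e x y.
Proof.
move=> n_gt0 sym_e; pose A := [set fingraph.root e x | x in 'I_n].
have A_root x : fingraph.root e x \in A by apply: imset_f.
pose c x := enum_rank_in (A_root (Ordinal n_gt0)) (fingraph.root e x).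
have cK x : enum_val (c x) = fingraph.root e x by rewrite enum_rankK_in.
exists #|A|, c; split=> [i|x y].
  have /imsetP[x _ ex] := enum_valP i; exists x; apply: enum_val_inj.
  by rewrite cK.
rewrite -(root_connect (sym_connect_sym sym_e)) -!cK.
by apply/eqP/eqP => [->|/enum_val_inj].
Qed.

Lemma sum_fiber_size (T I : finType) (c : T -> I) : \sum_i fiber_size c i = #|T|.
Proof.
rewrite -sum1_card (partition_big c predT) //=.
by apply: eq_bigr => i _; rewrite sum1_card.
Qed.

Section LinearAlgebra.
Local Open Scope ring_scope.
Variables (R : fieldType) (n : nat).

(** All rows are multiples of one nonzero row [x]; by symmetry the factors are,
    up to the scalar [S x x], the entries of that row. *)
Lemma symmetric_rank1 (S : 'M[R]_n) : S^T = S -> (\rank S <= 1)%N ->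
  exists (s : R) (w : 'rV_n), forall x y, S x y = s * w 0 x * w 0 y.
Proof.
move=> symS rank1; have [x nx|S0] := pickP (fun x => row x S != 0); last first.
  exists 0, 0 => x y; rewrite !mul0r.
  by have /negbFE/eqP/rowP/(_ y) := S0 x; rewrite !mxE.
have sub : (S <= row x S)%MS.
  rewrite -(geq_leqif (mxrank_leqif_sup (row_sub x S))) (leq_trans rank1) //.
  by rewrite lt0n mxrank_eq0.
have /submxP[D SE] := sub.
have {}SE y z : S y z = D y 0 * S x z.
  by rewrite {1}SE !mxE big_ord1 !mxE.
exists (S x x), D^T => y z; rewrite !mxE SE.
have -> : S x z = S z x by rewrite -[in LHS]symS mxE.
by rewrite SE; ring.
Qed.

End LinearAlgebra.

Section Forward.
Local Open Scope ring_scope.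
Variables (R : realType) (n k : nat) (G : rel 'I_n) (c : 'I_n -> 'I_k).
Hypothesis symG : symmetric G.
Hypothesis irrG : irreflexive G.
Hypothesis surj_c : forall i, exists x, c x = i.
Hypothesis c_connect : forall x y, (c x == c y) = connect (complement G) x y.
Local Notation M := (distance_laplacian R G).
Local Notation E := (class_indicator R c).
Local Notation J := (const_mx 1 : 'M[R]_n).
Implicit Types v w : 'rV[R]_n.

Lemma component_join x y : c x != c y -> G x y.
Proof.
apply: contraNT => nG; have [->|nxy] := eqVneq x y; first by rewrite eqxx.
by rewrite c_connect; apply: connect1; apply/andP.
Qed.

Lemma component_const v : (forall x y, x != y -> ~~ G x y -> v 0 x = v 0 y) ->
  forall x y, c x = c y -> v 0 x = v 0 y.
Proof.
move=> vG x y /eqP; rewrite c_connect => /connectP[p].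
elim: p x => [|z p IHp] x /= => [_ -> //|/andP[/andP[nxz nG] zp] yE].
by rewrite (vG _ _ nxz nG) (IHp z).
Qed.

(** Orthogonal projection onto the vectors that are constant on classes. *)
Definition class_projection : 'M[R]_n :=
  \matrix_(x, y) ((c x == c y)%:R / (fiber_size c (c y))%:R).
Local Notation P := class_projection.

Lemma mul_class_projection v y :
  (v *m P) 0 y = (\sum_(x | c x == c y) v 0 x) / (fiber_size c (c y))%:R.
Proof.
rewrite mxE mulr_suml [RHS]big_mkcond; apply: eq_bigr => x _.
by rewrite mxE; case: eqP; rewrite ?mul0r ?mulr0 ?mul1r.
Qed.

Lemma fiber_size_neq0 y : (fiber_size c (c y))%:R != 0 :> R.
Proof. by rewrite pnatr_eq0 -lt0n fiber_size_gt0. Qed.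

Lemma class_projection_const v :
  (forall x y, c x = c y -> v 0 x = v 0 y) -> v *m P = v.
Proof.
move=> vc; apply/rowP => y; rewrite mul_class_projection.
under eq_bigr => x /eqP cxy do rewrite (vc _ _ cxy).
rewrite sumr_const -[_ *+ _]mulr_natr; exact: (mulfK (fiber_size_neq0 y)).
Qed.

Lemma class_projection_sum0 v : v *m E^T = 0 -> v *m P = 0.
Proof.
move=> vE; apply/rowP => y.
by rewrite mul_class_projection (sum_classes vE) mul0r mxE.
Qed.

Lemma class_projection_tr : P^T = P.
Proof.
apply/matrixP => x y; rewrite !mxE eq_sym.
by case: eqP => [->//|_]; rewrite !mul0r.
Qed.

Lemma const_sub_indicator v :
  (forall x y, c x = c y -> v 0 x = v 0 y) -> (v <= E)%MS.
Proof.
move=> /class_projection_const <-.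
apply/submxP; exists (\row_i ((v *m E^T) 0 i / (fiber_size c i)%:R)).
apply/rowP => y; rewrite mul_class_indicator mxE mul_class_indicator_tr.
by rewrite mul_class_projection.
Qed.

Lemma row_indicator_const i x y : c x = c y -> row i E 0 x = row i E 0 y.
Proof. by rewrite !mxE => ->. Qed.

Lemma mul_ones v y : (v *m J) 0 y = \sum_x v 0 x.
Proof. by rewrite mxE; apply: eq_bigr => x _; rewrite mxE mulr1. Qed.

Lemma indicator_action : E *m M = n%:R *: E - E *m J.
Proof.
apply/row_matrixP => i; rewrite row_mul.
have -> : row i (n%:R *: E - E *m J) = n%:R *: row i E - row i E *m J.
  by rewrite linearB linearZ /= row_mul.
apply/rowP => y; rewrite (mul_class_constant component_join); last first.
  exact: row_indicator_const.
by rewrite -(mul_ones _ y) [RHS]mxE; congr (_ + _); rewrite [RHS]mxE.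
Qed.

(** The upper bound holds because the eigenvectors for [n], together with the
    constant vector, are independent inside the [k]-dimensional space of vectors
    that are constant on components. *)
Lemma multiplicity_order : (0 < multiplicity M n%:R)%N ->
  k = (multiplicity M n%:R).+1.
Proof.
move=> mult_gt0; apply/eqP; rewrite eqn_leq (multiplicity_order_ge R surj_c component_join) /=.
have n_gt0 : (0 < n)%N by apply: leq_trans mult_gt0 _; apply: rank_leq_col.
pose u : 'rV[R]_n := const_mx 1.
have u0 : u != 0.
  by apply/eqP => /rowP/(_ (Ordinal n_gt0))/eqP; rewrite !mxE oner_eq0.
have disj : (eigenspace M n%:R :&: u = 0)%MS.
  apply/eqP/rowV0P => v; rewrite sub_capmx => /andP[/eigenspaceP vM /sub_rVP[a va]].
  have : v *m M = 0 by rewrite va -scalemxAl const_distance_laplacian scaler0.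
  by rewrite vM => /eqP; rewrite scaler_eq0 pnatr_eq0 -leqn0 leqNgt n_gt0 => /eqP.
have := mxrank_disjoint_sum disj; rewrite rank_rV u0 addn1 => <-.
rewrite -(eqP (class_indicator_free R surj_c)); apply: mxrankS.
rewrite addsmx_sub; apply/andP; split; last first.
  by apply: const_sub_indicator => x y; rewrite !mxE.
apply/row_subP => i; apply/const_sub_indicator/component_const => x y.
apply: eigenvector_order_const => //; apply/eigenspaceP.
exact: row_sub.
Qed.

Variable theta : R.
Hypothesis theta_gt : n%:R < theta.
Local Notation mu := (theta - n%:R).

(** [M - n + J] is the Laplacian of the complement as soon as the diameter is at
    most two. If the components of the complement were complete graphs on one
    or [mu] vertices, then it would be [mu] times the projection [1 - P]. *)
Definition defect : 'M[R]_n := mu *: (1%:M - P) - (M - n%:R%:M + J).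
Local Notation S := defect.

Lemma defectE x y :
  S x y = mu * ((x == y)%:R - P x y) - (M x y - n%:R * (x == y)%:R + 1).
Proof.
rewrite /defect; move: M P => A B.
by rewrite !mxE -[n%:R *+ _]mulr_natr.
Qed.

Lemma defect_tr : S^T = S.
Proof.
apply/matrixP => x y; rewrite mxE !defectE [y == x]eq_sym.
by rewrite -[P in LHS]class_projection_tr -[M in LHS]distance_laplacian_tr // !(mxE trmx_key).
Qed.

(** On vectors constant on classes both [1 - P] and the Laplacian of the
    complement vanish. *)
Lemma indicator_defect : E *m S = 0.
Proof.
have EP : E *m P = E.
  apply/row_matrixP => i; rewrite row_mul class_projection_const //.
  exact: row_indicator_const.
rewrite /defect mulmxBr -scalemxAr mulmxBr mulmx1 EP subrr scaler0.
rewrite mulmxDr mulmxBr indicator_action mul_mx_scalar.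
by rewrite [_ - _ *m _ - _]addrAC subrr !add0r addNr oppr0.
Qed.

(** The class indicators are eigenvectors of [M] for [n] up to a constant
    vector, hence orthogonal to the eigenvectors for [theta]. *)
Lemma top_eigenvector_classes v : v *m M = theta *: v -> v *m E^T = 0.
Proof.
move=> vM; have theta0 : theta != 0.
  by rewrite gt_eqF // (le_lt_trans _ theta_gt).
have vJ : v *m J = 0.
  by apply/rowP => y; rewrite mul_ones (eigenvector_sum0 symG vM) // mxE.
have : v *m (E *m M)^T = theta *: (v *m E^T).
  by rewrite trmx_mul distance_laplacian_tr // mulmxA vM scalemxAl.
rewrite indicator_action linearB linearZ /= trmx_mul trmx_const mulmxBr mulmxA vJ.
rewrite mul0mx subr0 -scalemxAr => /eqP.
rewrite -subr_eq0 -scalerBl scaler_eq0 subr_eq0 (lt_eqF theta_gt) /=.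
by move/eqP.
Qed.

Lemma top_eigenvector_defect v : v *m M = theta *: v -> v *m S = 0.
Proof.
move=> vM; have vE := top_eigenvector_classes vM.
have vJ : v *m J = 0 by apply/rowP => y; rewrite mul_ones (sum_all_classes vE) mxE.
rewrite /defect mulmxBr -scalemxAr mulmxBr mulmx1 class_projection_sum0 // subr0.
by rewrite mulmxDr mulmxBr vM vJ mul_mx_scalar -scalerBl addr0 subrr.
Qed.

(** The kernel of the defect contains the indicators and the eigenspace of
    [theta], which are orthogonal to each other. *)
Lemma rank_defect : (\rank S + (k + multiplicity M theta) <= n)%N.
Proof.
have disj : (E :&: eigenspace M theta = 0)%MS.
  apply/eqP/rowV0P => v; rewrite sub_capmx => /andP[/submxP[w vw] /eigenspaceP vM].
  apply/rowP => y; rewrite [RHS]mxE.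
  apply: (const_class_eq0 (top_eigenvector_classes vM)) => x cxy.
  by rewrite vw !mul_class_indicator cxy.
have <- : \rank (E + eigenspace M theta) = (k + multiplicity M theta)%N.
  by rewrite mxrank_disjoint_sum // (eqP (class_indicator_free R surj_c)).
have : (E + eigenspace M theta <= kermx S)%MS.
  rewrite addsmx_sub; apply/andP; split; first by apply/sub_kermxP/indicator_defect.
  apply/row_subP => i; apply/sub_kermxP/top_eigenvector_defect/eigenspaceP.
  exact: row_sub.
by move/mxrankS; rewrite mxrank_ker; have := rank_leq_row S; lia.
Qed.

Hypothesis k_gt1 : (1 < k)%N.

Lemma defect_distinct_classes x y : c x != c y -> S x y = 0.
Proof.
move=> ncxy; have nxy : x != y by apply: contraNN ncxy => /eqP->.
rewrite !mxE -/(distance_laplacian R G) (negPf nxy) (negPf ncxy).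
rewrite (dist_distinct_classes component_join ncxy).
by rewrite !mulr0n; ring.
Qed.

Lemma defect_same_class x y : x != y -> c x = c y ->
  S x y = (~~ G x y)%:R - mu / (fiber_size c (c y))%:R.
Proof.
move=> nxy cxy; rewrite defectE distance_laplacian_offdiag // mxE cxy eqxx (negPf nxy).
have -> : dist G x y = (1 + ~~ G x y)%N.
  have [Gxy|nG] := boolP (G x y); first by rewrite dist_adj.
  exact: (dist_same_class surj_c component_join).
by rewrite natrD /=; ring.
Qed.

Let mu_gt0 : 0 < mu.
Proof. by rewrite subr_gt0. Qed.

Let size_gt0 y : 0 < (fiber_size c (c y))%:R :> R.
Proof. by rewrite ltr0n fiber_size_gt0. Qed.

Let ratio_gt0 y : 0 < mu / (fiber_size c (c y))%:R.
Proof. by rewrite divr_gt0. Qed.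

(** Off the diagonal the vanishing of the defect says [mu / h = 0] for adjacent
    vertices of a class of size [h], and [mu / h = 1] for nonadjacent ones. *)
Lemma defect0_independent x y :
  x != y -> c x = c y -> S x y = 0 -> ~~ G x y /\ (fiber_size c (c y))%:R = mu.
Proof.
move=> nxy cxy; rewrite (defect_same_class nxy cxy) => /eqP; rewrite subr_eq0.
case: (G x y) => /= /eqP h; first by have := ratio_gt0 y; rewrite -h ltxx.
split=> //; apply: (mulIf (invr_neq0 (fiber_size_neq0 y))).
by rewrite -h mulfV // fiber_size_neq0.
Qed.

Lemma defect0_class_size i :
    (forall x y, x != y -> c x = c y -> c y = i -> S x y = 0) ->
  fiber_size c i = 1%N \/ (fiber_size c i)%:R = mu.
Proof.
move=> S0; have [z zi] := surj_c i.
have := fiber_size_gt0 c z; rewrite zi leq_eqVlt => /predU1P[<-|]; first by left.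
case/card_gt1P => x [y [/eqP xi /eqP yi nxy]]; right.
have cxy : c x = c y by rewrite xi yi.
by have [_ <-] := defect0_independent nxy cxy (S0 _ _ nxy cxy yi); rewrite yi.
Qed.

Lemma defect0_multipartite : S = 0 ->
  (forall x y, G x y = (c x != c y))
  /\ forall i, fiber_size c i = 1%N \/ (fiber_size c i)%:R = mu.
Proof.
move=> S0; have S0xy x y : S x y = 0 by rewrite S0 mxE.
split=> [x y|i]; last exact: defect0_class_size.
have [cxy|nc] := eqVneq (c x) (c y); last exact: component_join.
have [->|nxy] := eqVneq x y; first exact: irrG.
by apply/negbTE; case: (defect0_independent nxy cxy (S0xy x y)).
Qed.

Hypothesis theta_max : forall a, (0 < multiplicity M a)%N -> a <= theta.

Variables (s : R) (w : 'rV[R]_n).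
Hypothesis defect_rank1 : forall x y, S x y = s * w 0 x * w 0 y.

(** A nonzero row of a defect of rank one is an eigenvector of [M] for
    [theta - s * |w|^2], so that [s] is positive because [theta] is the largest
    eigenvalue. *)
Lemma defect_sign : S != 0 ->
  [/\ 0 < s, (exists a, w 0 a != 0)
    & forall y, \sum_(x | c x == c y) w 0 x = 0].
Proof.
move=> S0.
have s0 : s != 0.
  apply: contra_neq S0 => s0; apply/matrixP => x y.
  by rewrite defect_rank1 s0 !mul0r mxE.
have [a wa] : exists a, w 0 a != 0.
  apply/existsP; apply: contra_neqT S0; rewrite negb_exists => /forallP w0.
  apply/matrixP => x y; rewrite defect_rank1.
  by have /negPn/eqP-> := w0 x; rewrite mulr0 mul0r mxE.
have wE : w *m E^T = 0.
  apply/rowP => i; rewrite [RHS]mxE.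
  have /matrixP/(_ i a) := indicator_defect; rewrite [RHS]mxE.
  have -> : (E *m S) i a = (w *m E^T) 0 i * (s * w 0 a).
    rewrite mxE [in RHS]mxE mulr_suml; apply: eq_bigr => x _.
    by rewrite defect_rank1 [E^T _ _]mxE; ring.
  by move/eqP; rewrite mulf_eq0 mulf_eq0 (negPf s0) (negPf wa) !orbF => /eqP.
pose q := \sum_x w 0 x ^+ 2.
have q_gt0 : 0 < q.
  rewrite /q (bigD1 a) //= ltr_pwDl ?sumr_ge0 // => [|x _]; last exact: sqr_ge0.
  by rewrite lt0r sqrf_eq0 wa sqr_ge0.
have wS : w *m S = (s * q) *: w.
  apply/rowP => y; rewrite mxE [RHS]mxE /q mulr_sumr mulr_suml.
  by apply: eq_bigr => x _; rewrite defect_rank1; ring.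
have wJ : w *m J = 0 by apply/rowP => y; rewrite mul_ones (sum_all_classes wE) mxE.
have wM : w *m M = (theta - s * q) *: w.
  move: wS; rewrite /defect mulmxBr -scalemxAr mulmxBr mulmx1 class_projection_sum0 // subr0.
  rewrite mulmxDr mulmxBr wJ mul_mx_scalar addr0 opprB addrA -scalerDl subrK => wS.
  by rewrite -[LHS](subKr (theta *: w)) wS -scalerBl.
have w0 : w != 0 by apply: contra_neq wa => ->; rewrite mxE.
have := theta_max (multiplicity_gt0 w0 wM).
rewrite lerBlDr lerDl pmulr_lge0 // => s_ge0.
by split; [rewrite lt0r s0 | exists a | exact: sum_classes].
Qed.

(** The support of [w] lies in one class; call [h] its size and [a], [b] two of
    its vertices where [w] has opposite signs. There [w x * w y] is a positive
    multiple of [1 - mu / h] for nonadjacent and of [- mu / h] for adjacent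
    vertices. If [mu < h], then [w] keeps its sign along paths of the
    complement, which join [a] to [b]. If [mu > h], then any two vertices have
    opposite signs, so there are only two. If [mu = h], then two vertices are
    adjacent exactly if [w] vanishes at neither; adjacent vertices have opposite
    signs, so the only edge is [a b]; and [h > 2], since [a] has a neighbour in the
    complement. *)
Lemma defect_rank1_shape : S != 0 ->
  exists a b e, [/\ a != b, c a = c b,
      forall x y, G x y = (c x != c y) || e && same_edge a b x y,
      forall i, i != c a -> fiber_size c i = 1%N \/ (fiber_size c i)%:R = mu
    & if e then (fiber_size c (c a))%:R = mu /\ (2 < fiber_size c (c a))%N
      else fiber_size c (c a) = 2%N /\ 2 < mu].
Proof.
move=> /defect_sign [s_gt0 [a wa] sum0].
have [b cba wab] : exists2 b, c b = c a & w 0 a * w 0 b < 0.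
  have [b /andP[/eqP cba wab]|none] := pickP (fun b => (c b == c a) && (w 0 a * w 0 b < 0)).
    by exists b.
  have ge0 x : c x == c a -> 0 <= w 0 a * w 0 x.
    by move=> cx; have := none x; rewrite cx /= ltNge => /negbFE.
  have sum_a : \sum_(x | c x == c a) w 0 a * w 0 x = 0 by rewrite -mulr_sumr sum0 mulr0.
  have /eqP := psumr_eq0P ge0 sum_a (eqxx (c a)).
  by rewrite mulf_eq0 (negPf wa).
have nab : a != b by apply: contraTneq wab => <-; rewrite -leNgt -expr2 sqr_ge0.
have cab : c a = c b by [].
have signE x y : x != y -> c x = c a -> c y = c a ->
    w 0 x * w 0 y = ((~~ G x y)%:R - mu / (fiber_size c (c a))%:R) / s.
  move=> nxy cx cy; rewrite -cy -defect_same_class ?cx // defect_rank1.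
  by field; rewrite gt_eqF.
have lt0M x y z : w 0 x * w 0 y < 0 -> w 0 x * w 0 z < 0 -> w 0 y * w 0 z < 0 -> False.
  move=> xy xz yz; have : 0 < (w 0 x * w 0 y) * (w 0 x * w 0 z) by rewrite nmulr_rgt0.
  have -> : (w 0 x * w 0 y) * (w 0 x * w 0 z) = w 0 x ^+ 2 * (w 0 y * w 0 z) by ring.
  by apply/negP; rewrite -leNgt mulr_ge0_le0 ?sqr_ge0 // ltW.
have outside x : c x != c a -> w 0 x = 0.
  move=> ncx; have := defect_rank1 x a; rewrite defect_distinct_classes // => /esym/eqP.
  by rewrite !mulf_eq0 (negPf wa) (gt_eqF s_gt0) orbF => /eqP.
have outG x y : x != y -> c x = c y -> c y != c a -> ~~ G x y.
  move=> nxy cxy nc; case: (defect0_independent nxy cxy) => //.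
  by rewrite defect_rank1 (outside y) // mulr0.
have outsize i : i != c a -> fiber_size c i = 1%N \/ (fiber_size c i)%:R = mu.
  move=> ni; apply: defect0_class_size => x y _ _ yi.
  by rewrite defect_rank1 (outside y) ?mulr0 // yi.
set h := fiber_size c (c a).
(* The first step of a path of the complement from [a] to [b]. *)
have [x1 [nx1 nGx1 cx1]] : exists x, [/\ a != x, ~~ G a x & c x = c a].
  have : connect (complement G) a b by rewrite -c_connect cab.
  case/connectP => -[|x p] /=; first by move=> _ ba; rewrite ba eqxx in nab.
  case/andP=> /andP[nax nGax] _ _; exists x; split=> //.
  by apply/esym/eqP; rewrite c_connect connect1 //; apply/andP.
have h_gt0 : 0 < h%:R :> R by apply: size_gt0.
have others x : c x = c a -> x = a \/ x = b \/ [/\ a != x & b != x].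
  move=> _; have [->|nxa] := eqVneq a x; first by left.
  by have [->|nxb] := eqVneq b x; right; [left | right].
have [lt_mu|gt_mu|eq_mu] := ltrgtP mu h%:R.
- have pos p z : path (complement G) z p -> c z = c a -> 0 < w 0 a * w 0 z ->
      0 < w 0 a * w 0 (last z p).
    elim: p z => [//|y p IHp] z /= /andP[/[dup] zy /andP[nzy nG] yp] cz az.
    have cy : c y = c a by rewrite -cz; apply/esym/eqP; rewrite c_connect connect1.
    apply: IHp => //; have zy_gt0 : 0 < w 0 z * w 0 y.
      by rewrite signE // nG divr_gt0 // subr_gt0 ltr_pdivrMr // mul1r.
    have : 0 < (w 0 a * w 0 z) * (w 0 z * w 0 y) by rewrite mulr_gt0.
    have -> : (w 0 a * w 0 z) * (w 0 z * w 0 y) = w 0 z ^+ 2 * (w 0 a * w 0 y) by ring.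
    rewrite pmulr_rgt0 // lt0r sqr_ge0 sqrf_eq0 andbT.
    by apply: contraTneq az => ->; rewrite mulr0 ltxx.
  have : connect (complement G) a b by rewrite -c_connect cab.
  case/connectP => p ap bE; have := pos p a ap (erefl _).
  by rewrite -bE -expr2 lt0r sqrf_eq0 wa sqr_ge0 => /(_ isT); rewrite ltNge ltW.
- have neg x y : x != y -> c x = c a -> c y = c a -> w 0 x * w 0 y < 0.
    move=> nxy cx cy; rewrite signE // pmulr_llt0 ?invr_gt0 // subr_lt0.
    apply: (@le_lt_trans _ _ 1); first by rewrite lern1; case: (~~ _).
    by rewrite ltr_pdivlMr // mul1r.
  have class_ab x : c x = c a -> x = a \/ x = b.
    move=> cx; case: (others x cx) => [->|[->|[nax nbx]]]; [by left|by right|].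
    by case: (lt0M a b x); apply: neg.
  have h2 : h = 2%N.
    have : #|[set a; b]| = 2%N by rewrite cards2 nab.
    move<-; apply: eq_card => x; rewrite !inE; apply/eqP/orP => [/class_ab[]->|[]/eqP->//].
      by left.
    by right.
  exists a, b, false; split=> // [x y|]; last by rewrite -/h h2; split=> //; rewrite -h2.
  have [cxy|nc] := eqVneq (c x) (c y); last exact: component_join.
  have [->|nxy] := eqVneq x y; first exact: irrG.
  have [cx|ncx] := eqVneq (c x) (c a); last first.
    by apply/negbTE/outG; rewrite -?cxy.
  have nGab : ~~ G a b.
    by case: (class_ab _ cx1) nx1 nGx1 => ->; rewrite ?eqxx.
  apply/negbTE; have cy : c y = c a by rewrite -cxy.
  case: (class_ab _ cx) (class_ab _ cy) nxy => -> [] ->; rewrite ?eqxx // => _.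
  by rewrite symG.
have muh : mu / h%:R = 1 by rewrite eq_mu mulfV // gt_eqF.
have neg x y : x != y -> c x = c a -> c y = c a -> w 0 x * w 0 y != 0 ->
    G x y /\ w 0 x * w 0 y < 0.
  move=> nxy cx cy; rewrite signE // -/h muh.
  case: (G x y) => /=; last by rewrite subrr mul0r eqxx.
  by move=> _; rewrite sub0r mulNr mul1r oppr_lt0 invr_gt0.
have Gab : G a b by case: (neg a b nab erefl cba) => //; rewrite lt_eqF.
have w0 x : c x = c a -> a != x -> b != x -> w 0 x = 0.
  move=> cx nax nbx; apply/eqP/negPn/negP => wx.
  have wb : w 0 b != 0 by apply: contraTneq wab => ->; rewrite mulr0 ltxx.
  have [_ ax] := neg a x nax erefl cx (mulf_neq0 wa wx).
  have [_ bx] := neg b x nbx cba cx (mulf_neq0 wb wx).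
  exact: lt0M wab ax bx.
have inside x y : x != y -> c x = c a -> c y = c a -> w 0 x * w 0 y = 0 -> ~~ G x y.
  move=> nxy cx cy; rewrite signE // -/h muh; case: (G x y) => //=.
  by move/eqP; rewrite sub0r mulNr mul1r oppr_eq0 invr_eq0 (gt_eqF s_gt0).
exists a, b, true; split=> // [x y|].
  have [cxy|nc] := eqVneq (c x) (c y); last exact: component_join.
  have [->|nxy] := eqVneq x y.
    rewrite irrG /=; apply/esym/negbTE; rewrite negb_or.
    by apply/andP; split; apply/negP => /andP[/eqP-> /eqP]; [|move/esym]; apply/eqP.
  have [cx|ncx] := eqVneq (c x) (c a); last first.
    rewrite (negPf (outG _ _ nxy cxy _)) -?cxy //=; apply/esym/negbTE; rewrite negb_or.
    by apply/andP; split; apply: contraNN ncx => /andP[/eqP-> _]; rewrite ?cab.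
  have cy : c y = c a by rewrite -cxy.
  have [/orP[]/andP[/eqP-> /eqP->]|nxy_ab] := boolP (same_edge a b x y).
  - by rewrite Gab.
  - by rewrite symG Gab.
  apply/negbTE/inside => //; move: nxy nxy_ab; rewrite /same_edge /=.
  case: (others x cx) => [->|[->|[nax nbx]]]; last by rewrite w0 // mul0r.
    case: (others y cy) => [->|[->|[nay nby]]]; first by rewrite eqxx.
      by rewrite !eqxx.
    by rewrite (w0 y) // mulr0.
  case: (others y cy) => [->|[->|[nay nby]]]; first by rewrite !eqxx orbT.
    by rewrite eqxx.
  by rewrite (w0 y) // mulr0.
rewrite -/h -eq_mu; split=> //.
have us : uniq [:: a; b; x1].
  rewrite /= !inE negb_or nab nx1 !andbT /=.
  by apply/eqP => bx; move: nGx1; rewrite -bx Gab.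
have <- : #|[:: a; b; x1]| = 3%N by rewrite (card_uniqP us).
apply/subset_leq_card/subsetP => x; rewrite !inE.
by case/or3P => /eqP->; rewrite ?cba ?cx1 eqxx.
Qed.

End Forward.

(** * Spectral characterizations *)

Definition multipartite_shape n (G : rel 'I_n) (k p : nat) : Prop :=
  exists c : 'I_n -> 'I_k,
    [/\ forall i, 0 < fiber_size c i,
        forall x y, G x y = (c x != c y)
      & forall i, fiber_size c i = 1 \/ fiber_size c i = p].

(** The two exceptional shapes share one definition because one argument yields
    both: for [p > 2] the class of [a] and [b] is the component of the complement
    that carries the eigenvalue strictly between [n] and the largest one. *)
Definition near_multipartite_shape n (G : rel 'I_n) (k p : nat) (e : bool) : Prop :=
  exists (c : 'I_n -> 'I_k) (a b : 'I_n),
    [/\ forall i, 0 < fiber_size c i,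
        a != b /\ c a = c b,
        forall x y, G x y = (c x != c y) || e && same_edge a b x y,
        forall i, i != c a -> fiber_size c i = 1 \/ fiber_size c i = p
      & fiber_size c (c a) = if e then p else 2].

Lemma fiber_size_surj (T I : finType) (c : T -> I) :
  (forall i, 0 < fiber_size c i) <-> (forall i, exists x, c x = i).
Proof.
split=> h i; first by have /card_gt0P[x /eqP] := h i; exists x.
by have [x <-] := h i; apply/card_gt0P; exists x; rewrite inE.
Qed.

Section Characterizations.
Local Open Scope ring_scope.
Variables (R : realType) (n k : nat) (G : rel 'I_n).
Hypothesis simple_G : simple_graph G.
Hypothesis k_gt1 : (1 < k)%N.
Local Notation M := (distance_laplacian R G).

(** The multiplicity of [n] is too small to fill the list of eigenvalues down to
    its entry before last, so something larger than [n] comes first. *)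
Lemma top_eigenvalue_gt : (0 < multiplicity M n%:R < n - 1)%N ->
    dl_eigenvalue R G (n - 1) = n%:R ->
  n%:R < dl_eigenvalue R G 1
  /\ forall a, (0 < multiplicity M a)%N -> a <= dl_eigenvalue R G 1.
Proof.
move=> /andP[mult_gt0 mult_lt].
rewrite /dl_eigenvalue /=; move=> spec_n.
have n_neq0 : n%:R != 0 :> R by rewrite pnatr_eq0; lia.
have spec0 : spectrum M != [::].
  by apply: contra_neq n_neq0 => s0; rewrite -spec_n s0 nth_nil.
have [_ maxP [s specE s_lt]] := spectrum_head spec0; split=> //.
rewrite lt_neqAle maxP // andbT; apply/eqP => top_n.
move: spec_n; rewrite specE -top_n nth_cat size_nseq.
have -> : ((n - 1).-1 < multiplicity M n%:R)%N = false by lia.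
set j := (_ - _)%N; have [lt_j|le_j] := ltnP j (size s).
  by have := s_lt _ (mem_nth 0 lt_j); rewrite -top_n => /[swap]->; rewrite ltxx.
by rewrite nth_default // => /esym/eqP; apply/negP.
Qed.

Let complement_sym : symmetric (complement G).
Proof. by move=> x y; rewrite /complement /= eq_sym (proj1 simple_G). Qed.

Lemma component_map_order : multiplicity M n%:R = (k - 1)%N ->
  exists c : 'I_n -> 'I_k, (forall i, exists x, c x = i)
    /\ forall x y, (c x == c y) = connect (complement G) x y.
Proof.
move=> mult_n; have n_gt0 : (0 < n)%N.
  by have := rank_leq_col (eigenspace M n%:R); rewrite -/(multiplicity _ _) mult_n; lia.
have [k' [c [surj_c cE]]] := component_map n_gt0 complement_sym.
have kE : k' = k.
  have := @multiplicity_order R _ _ _ _ (proj1 simple_G) surj_c cE.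
  by rewrite mult_n; lia.
by move: c surj_c cE; rewrite kE => c surj_c cE; exists c.
Qed.

(** The number [mu] is the size of a class, because not all classes are
    singletons when [k < n]. *)
Lemma multipartite_shape_real (c : 'I_n -> 'I_k) (mu : R) :
    (k < n)%N -> (forall i, exists x, c x = i) ->
    (forall x y, G x y = (c x != c y)) ->
    (forall i, fiber_size c i = 1%N \/ (fiber_size c i)%:R = mu) ->
  exists2 p, (1 < p)%N & multipartite_shape G k p.
Proof.
move=> k_lt_n surj_c GE sizes; have gt0 := (fiber_size_surj c).2 surj_c.
have [i ni|all1] := pickP (fun i => fiber_size c i != 1%N); last first.
  have := sum_fiber_size c; rewrite card_ord (eq_bigr (fun=> 1%N)).
    by rewrite sum1_card card_ord; lia.
  by move=> i _; have /negbFE/eqP := all1 i.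
exists (fiber_size c i); first by have := gt0 i; lia.
exists c; split=> // j; have [->|jmu] := sizes j; [by left|right].
have [i1|imu] := sizes i; first by rewrite i1 in ni.
by apply/eqP; rewrite -(eqr_nat R) jmu imu.
Qed.

Lemma multipartite_spectrumP : (k < n)%N ->
  [/\ dl_multiplicity G (dl_eigenvalue R G 1) = (n - k)%N,
      dl_eigenvalue R G (n - 1) = n%:R
    & dl_multiplicity G (n%:R : R) = (k - 1)%N]
  <-> exists2 p, (1 < p)%N & multipartite_shape G k p.
Proof.
move=> k_lt_n; split; last first.
  move=> [p p_gt1 [c [/fiber_size_surj surj_c GE sizes]]].
  exact: (multipartite_spectrum R surj_c k_gt1 GE sizes).
case; rewrite /dl_multiplicity => mult_top spec_n mult_n.
have [|theta_gt _] := top_eigenvalue_gt _ spec_n; first by rewrite mult_n; lia.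
have [symG irrG] := simple_G.
have [c [surj_c cE]] := component_map_order mult_n.
have := rank_defect symG surj_c cE theta_gt.
rewrite mult_top => rank_le.
have S0 : defect G c (dl_eigenvalue R G 1) = 0.
  by apply/eqP; rewrite -mxrank_eq0; lia.
have [GE sizes] := defect0_multipartite irrG surj_c cE theta_gt k_gt1 S0.
exact: multipartite_shape_real sizes.
Qed.

(** The defect cannot vanish: a multipartite graph would give the largest
    eigenvalue multiplicity [n - k]. *)
Lemma near_multipartite_spectrumP : (k.+1 < n)%N ->
  [/\ dl_multiplicity G (dl_eigenvalue R G 1) = (n - k.+1)%N,
      dl_eigenvalue R G (n - 1) = n%:R
    & dl_multiplicity G (n%:R : R) = (k - 1)%N]
  <-> exists p e, (2 < p)%N /\ near_multipartite_shape G k p e.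
Proof.
move=> k_lt_n; split; last first.
  move=> [p [e [p_gt2 [c [a [b [/fiber_size_surj surj_c [nab cab] GE sizes size_a]]]]]]].
  exact: (near_multipartite_spectrum R surj_c k_gt1 GE nab cab sizes size_a).
case; rewrite /dl_multiplicity => mult_top spec_n mult_n.
have [|theta_gt theta_max] := top_eigenvalue_gt _ spec_n; first by rewrite mult_n; lia.
have [symG irrG] := simple_G.
have [c [surj_c cE]] := component_map_order mult_n.
have := rank_defect symG surj_c cE theta_gt.
rewrite mult_top => rank_le.
have gt0 := (fiber_size_surj c).2 surj_c.
have S0 : defect G c (dl_eigenvalue R G 1) != 0.
  apply/eqP => S0.
  have [GE sizes] := defect0_multipartite irrG surj_c cE theta_gt k_gt1 S0.
  have k_lt_n' : (k < n)%N := ltnW k_lt_n.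
  have /(multipartite_spectrumP k_lt_n')[mult_top' _ _] :=
    multipartite_shape_real k_lt_n' surj_c GE sizes.
  by move: mult_top'; rewrite /dl_multiplicity mult_top; lia.
have [s [w SE]] : exists (s : R) (w : 'rV_n), forall x y,
    defect G c (dl_eigenvalue R G 1) x y = s * w 0 x * w 0 y.
  by apply: symmetric_rank1; [apply: defect_tr | lia].
have [a [b [e [nab cab GE sizes size_a]]]] :=
  defect_rank1_shape symG irrG surj_c cE theta_gt k_gt1 theta_max SE S0.
have [p [p_gt2 pE size_aE]] : exists p, [/\ (2 < p)%N,
    forall i, i != c a -> fiber_size c i = 1%N \/ fiber_size c i = p
  & fiber_size c (c a) = if e then p else 2%N].
  have sizes_p p : p%:R = dl_eigenvalue R G 1 - n%:R ->
      forall i, i != c a -> fiber_size c i = 1%N \/ fiber_size c i = p.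
    move=> pmu i /sizes[->|imu]; [by left|right].
    by apply/eqP; rewrite -(eqr_nat R) imu pmu.
  case: e size_a {GE} => -[size_a gt2].
    by exists (fiber_size c (c a)); split=> //; apply: sizes_p.
  have [i /andP[ia ni]|all1] := pickP (fun i => (i != c a) && (fiber_size c i != 1%N)).
    have [i1|imu] := sizes i ia; first by rewrite i1 in ni.
    exists (fiber_size c i); split=> //; last exact: sizes_p.
    by rewrite -(ltr_nat R) imu.
  have := sum_fiber_size c; rewrite card_ord (bigD1 (c a)) //= size_a.
  rewrite (eq_bigr (fun=> 1%N)) ?sum1_card => [|i ia]; last first.
    by have := all1 i; rewrite ia => /negbFE/eqP.
  by rewrite -[#|_|]/#|predC1 (c a)| cardC1 card_ord; lia.
by exists p, e; split=> //; exists c, a, b; split.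
Qed.

End Characterizations.

(** * Isomorphisms from class sizes *)

Section ClassIsomorphism.
Variables (T U I : finType).

Lemma fiber_size_bij (f : T -> U) (d : U -> I) i : bijective f ->
  fiber_size (fun x => d (f x)) i = fiber_size d i.
Proof.
move=> [g fK gK]; rewrite /fiber_size.
rewrite -(card_image (can_inj fK)); apply: eq_card => u.
apply/imageP/idP => [[x + ->]|du]; first by rewrite !inE.
by exists (g u); rewrite ?inE gK.
Qed.

(** Match the members of corresponding fibers by their ranks in the
    enumerations of these fibers. *)
Lemma fiber_bijection (c : T -> I) (d : U -> I) :
    (forall i, fiber_size c i = fiber_size d i) ->
  exists2 f : T -> U, bijective f & forall x, d (f x) = c x.
Proof.
move=> cd; have card_TU : #|T| = #|U|.
  by rewrite -(sum_fiber_size c) -(sum_fiber_size d); apply: eq_bigr.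
have [x0 _|T0] := pickP (fun _ : T => true); last first.
  have f : T -> U by move=> x; have := T0 x.
  exists f => [|x]; last by have := T0 x.
  by apply: inj_card_bij => [x|]; [have := T0 x | rewrite card_TU].
have [u0 _] : exists u, u \in [pred u | d u == c x0].
  by apply/card_gt0P; rewrite -[#|_|]/(fiber_size d _) -cd; apply/card_gt0P; exists x0; rewrite inE.
pose A i := enum [pred x | c x == i]; pose B i := enum [pred u | d u == i].
have sAB i : size (A i) = size (B i) by rewrite -!cardE; apply: cd.
have memA x : x \in A (c x) by rewrite mem_enum inE.
pose f x := nth u0 (B (c x)) (index x (A (c x))).
have idx x : index x (A (c x)) < size (B (c x)) by rewrite -sAB index_mem.
have df x : d (f x) = c x.
  by have := mem_nth u0 (idx x); rewrite mem_enum inE => /eqP.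
exists f => //; apply: inj_card_bij; last by rewrite card_TU.
move=> x y fxy; have cxy : c x = c y by rewrite -!df fxy.
move: fxy (idx x) (memA x); rewrite /f cxy => /eqP + ix xA.
rewrite nth_uniq ?enum_uniq //; move/eqP => eq_idx.
by have := nth_index x xA; rewrite eq_idx nth_index.
Qed.

End ClassIsomorphism.

Lemma graph_iso_sym (T U : finType) (G : rel T) (H : rel U) :
  graph_iso G H -> graph_iso H G.
Proof.
by move=> [f [g fK gK] GH]; exists g => [|x y]; [exists f | rewrite -GH !gK].
Qed.

Lemma graph_iso_trans (T U V : finType) (G : rel T) (H : rel U) (K : rel V) :
  graph_iso G H -> graph_iso H K -> graph_iso G K.
Proof.
move=> [f bf GH] [g bg HK]; exists (g \o f); first exact: bij_comp.
by move=> x y; rewrite /= HK GH.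
Qed.

Lemma same_edge_bij (T U : finType) (f : T -> U) a b x y : injective f ->
  same_edge (f a) (f b) (f x) (f y) = same_edge a b x y.
Proof. by move=> inj_f; rewrite /same_edge /= !(inj_eq inj_f). Qed.

Lemma iso_add_edge_trans (T U V : finType) (G : rel T) (H : rel U) (K : rel V) :
  iso_add_edge G H -> graph_iso H K -> iso_add_edge G K.
Proof.
move=> [a [b [nab nH GH]]] [f bf HK]; have inj_f := bij_inj bf.
exists (f a), (f b); split; rewrite ?(inj_eq inj_f) ?HK //.
apply: graph_iso_trans GH _; exists f => // x y.
by rewrite /add_edge /= HK same_edge_bij.
Qed.

Lemma fiber_size_multipartite t (i : 'I_(size t)) :
  fiber_size (fun u : multipartite_vertex t => tag u) i = nth 0 t i.
Proof.
pose g (j : 'I_(nth 0 t i)) : multipartite_vertex t := Tagged (fun i : 'I_(size t) => 'I_(nth 0 t i)) j.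
have inj_g : injective g.
  by move=> j1 j2 /eqP; rewrite -tag_eqE /tag_eq eqxx tagged_asE => /eqP.
rewrite /fiber_size -[RHS]card_ord -(card_image inj_g); apply: eq_card => u.
rewrite !inE; apply/eqP/imageP => [|[j _ ->] //].
by case: u => i' j /= ii; subst i'; exists j.
Qed.

Section MultipartiteIsomorphism.
Variables (T : finType) (G : rel T) (t : seq nat).
Local Notation K := (@complete_multipartite t).

Lemma iso_multipartiteP : graph_iso G K <->
  exists c : T -> 'I_(size t), (forall i, fiber_size c i = nth 0 t i)
    /\ forall x y, G x y = (c x != c y).
Proof.
split=> [[f bf GK]|[c [ct GE]]].
  exists (fun x => tag (f x)); split=> [i|x y]; last by rewrite -GK.
  by rewrite (fiber_size_bij (fun u => tag u) i bf) fiber_size_multipartite.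
have [|f bf fE] := @fiber_bijection _ _ _ c (fun u : multipartite_vertex t => tag u).
  by move=> i; rewrite ct fiber_size_multipartite.
by exists f => // x y; rewrite /complete_multipartite /= !fE GE.
Qed.

Lemma iso_add_edge_multipartiteP : iso_add_edge G K <->
  exists (c : T -> 'I_(size t)) a b, [/\ forall i, fiber_size c i = nth 0 t i,
     a != b, c a = c b
   & forall x y, G x y = (c x != c y) || same_edge a b x y].
Proof.
split=> [[a [b [nab nK [f bf GK]]]]|[c [a [b [ct nab cab GE]]]]].
  have [g fK gK] := bf; exists (fun x => tag (f x)), (g a), (g b); split.
  - by move=> i; rewrite (fiber_size_bij (fun u => tag u) i bf) fiber_size_multipartite.
  - by rewrite (inj_eq (can_inj gK)).
  - by rewrite !gK; apply/eqP; move: nK; rewrite /complete_multipartite /= negbK.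
  move=> x y; rewrite -GK -(same_edge_bij (g a) (g b) x y (can_inj fK)) !gK.
  by [].
have [|f bf fE] := @fiber_bijection _ _ _ c (fun u : multipartite_vertex t => tag u).
  by move=> i; rewrite ct fiber_size_multipartite.
have inj_f := bij_inj bf.
exists (f a), (f b); split; rewrite ?(inj_eq inj_f) // /complete_multipartite /=.
  by rewrite !fE cab eqxx.
exists f => // x y; rewrite GE -(same_edge_bij a b x y inj_f).
by rewrite /add_edge /= !fE.
Qed.

End MultipartiteIsomorphism.

Lemma reorder_classes (T : finType) k (c : T -> 'I_k) (t : seq nat) :
    perm_eq [seq fiber_size c i | i <- enum 'I_k] t ->
  exists c' : T -> 'I_(size t), (forall i, fiber_size c' i = nth 0 t i)
    /\ forall x y, (c' x == c' y) = (c x == c y).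
Proof.
move=> perm_t; have kE : k = size t.
  by rewrite -(perm_size perm_t) size_map -cardE card_ord.
move: c perm_t; rewrite kE => c; rewrite perm_sym.
have -> : [seq fiber_size c i | i <- enum 'I_(size t)]
        = [tuple fiber_size c i | i < size t] by [].
move=> perm_t; have /tuple_permP[p tE] := perm_t.
exists (fun x => (p^-1)%g (c x)); split=> [i|x y]; last by rewrite (inj_eq perm_inj).
have -> : nth 0 t i = fiber_size c (p i).
  rewrite (congr1 (fun u => nth 0 u i) tE) -[nth _ _ _]/(nth 0 (tval _) i).
  by rewrite -tnth_nth !tnth_mktuple.
apply: eq_card => x; rewrite !inE.
by rewrite -(inj_eq (@perm_inj _ p)) permKV.
Qed.

(** A complete split graph is complete multipartite: the independent part is one
    class, and every vertex of the clique is a class by itself. *)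
Lemma complete_split_multipartite n a :
  graph_iso (@complete_split n a) (@complete_multipartite (a :: nseq (n - a) 1)).
Proof.
pose d (u : 'I_a + 'I_(n - a)) : 'I_(n - a).+1 :=
  if u is inr j then lift ord0 j else ord0.
have szE : (n - a).+1 = size (a :: nseq (n - a) 1) by rewrite /= size_nseq.
apply/iso_multipartiteP; exists (fun u => cast_ord szE (d u)); split; last first.
  case=> [x|x] [y|y]; rewrite (inj_eq (@cast_ord_inj _ _ szE)) /d /complete_split
    /complement /disjoint_union /complete_graph /empty_graph /= ?eqxx //.
  - rewrite (inj_eq inl_inj). by case: eqP.
  - by rewrite andbT (inj_eq lift_inj) (inj_eq inr_inj).
move=> i; rewrite /fiber_size.
have dE u : (cast_ord szE (d u) == i) = (d u == cast_ord (esym szE) i).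
  by apply/eqP/eqP => [<-|->]; rewrite ?cast_ordK ?cast_ordKV.
have -> : nth 0 (a :: nseq (n - a) 1) i = nth 0 (a :: nseq (n - a) 1) (cast_ord (esym szE) i) by [].
rewrite (eq_card (B := [pred u | d u == cast_ord (esym szE) i])) => [|u]; last by rewrite !inE dE.
case: (unliftP ord0 (cast_ord (esym szE) i)) => [j|] -> /=.
  rewrite nth_nseq ltn_ord -[RHS](card1 (inr j : 'I_a + 'I_(n - a))).
  by apply: eq_card => -[x|x]; rewrite !inE ?(inj_eq lift_inj) ?(inj_eq inr_inj).
rewrite -[RHS]card_ord -(card_image (@inl_inj 'I_a 'I_(n - a))); apply: eq_card => -[x|x]; rewrite !inE.
  by rewrite eqxx; apply/esym/imageP; exists x.
by apply/esym/negbTE/negP => /imageP[].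
Qed.

(** * The listed graphs *)

Lemma degree_complete_split_indep n a (x : 'I_a) :
  degree (@complete_split n a) (inl x) = n - a.
Proof.
rewrite -[RHS]card_ord -(card_image (@inr_inj 'I_a 'I_(n - a))).
apply: eq_card => -[y|y]; rewrite !inE /complete_split /complement /=; last first.
  by apply/esym/imageP; exists y.
transitivity false; last by apply/esym/negbTE/negP => /imageP[].
by rewrite (inj_eq (@inl_inj _ _)) /complete_graph /=; case: eqP.
Qed.

Lemma degree_complete_split_clique n a (x : 'I_(n - a)) : a <= n ->
  degree (@complete_split n a) (inr x) = n - 1.
Proof.
move=> le_an; have -> : n - 1 = #|predC1 (inr x : 'I_a + 'I_(n - a))|.
  by rewrite cardC1 card_sum !card_ord subnKC // subn1.
apply: eq_card => -[y|y]; rewrite !inE /complete_split /complement //=.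
by rewrite /empty_graph /= andbT eq_sym.
Qed.

(** Deleting an edge between two of the three universal vertices merges the
    classes of its endpoints. *)
Lemma del_edge_complete_split n a (i j : 'I_(n - a)) : n - a = 3 -> i != j ->
  graph_iso (del_edge (@complete_split n a) (inr i) (inr j))
            (@complete_multipartite [:: a; 2; 1]).
Proof.
move=> na3 nij; apply/iso_multipartiteP.
pose d (u : 'I_a + 'I_(n - a)) : 'I_3 :=
  if u is inr x then if (x == i) || (x == j) then inord 1 else inord 2 else inord 0.
have inordE (x y : nat) : x < 3 -> y < 3 -> (inord x == inord y :> 'I_3) = (x == y).
  by move=> x3 y3; apply/eqP/eqP => [/(congr1 val)|->//]; rewrite /= !inordK.
have one_left x y : x != i -> x != j -> y != i -> y != j -> x = y.
  move=> xi xj yi yj; apply/eqP/negPn/negP => nxy.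
  have us : uniq [:: i; j; x; y].
    by rewrite /= !inE !negb_or nij ![i == _]eq_sym ![j == _]eq_sym xi xj yi yj nxy.
  by have := max_card (mem [:: i; j; x; y]); rewrite (card_uniqP us) /= card_ord na3.
have inlr (x : 'I_a) (y : 'I_(n - a)) : (inl x == inr y) = false by [].
exists d; split; last first.
  case=> [x|x] [y|y]; rewrite /del_edge /complete_split /complement /disjoint_union
    /complete_graph /empty_graph /same_edge /=.
  - by rewrite (inj_eq (@inl_inj _ _)) inordE // eqxx; case: (x == y).
  - by case: ifP => _; rewrite inordE.
  - by rewrite !inlr !andbF; case: ifP => _; rewrite inordE.
  rewrite !(inj_eq (@inr_inj _ _)) andbT.
  have [->|nxi] := eqVneq x i; have [->|nyi] := eqVneq y i;
    rewrite ?eqxx ?(negPf nij) /= ?orbF ?andbF ?andbT //=.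
  - by case: (eqVneq y j) => _ /=; rewrite ?eqxx ?inordE.
  - by case: (eqVneq x j) => _ /=; rewrite ?eqxx ?nxi ?inordE.
  case: (eqVneq x j) => [->|nxj]; case: (eqVneq y j) => [yj|nyj] /=;
    rewrite ?yj ?eqxx ?nxj ?inordE //.
  by rewrite (one_left x y) ?eqxx.
have size0 : fiber_size d (inord 0) = a.
  rewrite -[RHS]card_ord -(card_image (@inl_inj 'I_a 'I_(n - a))).
  apply: eq_card => -[x|x]; rewrite !inE /=.
    by rewrite eqxx; apply/esym/imageP; exists x.
  transitivity false; last by apply/esym/negbTE/negP => /imageP[].
  by case: ifP => _; rewrite inordE.
have size1 : fiber_size d (inord 1) = 2.
  transitivity #|[set (inr i : 'I_a + 'I_(n - a)); inr j]|; last first.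
    by rewrite cards2 (inj_eq (@inr_inj _ _)) nij.
  apply: eq_card => -[x|x]; rewrite !inE /=; first by rewrite inordE.
  rewrite !(inj_eq (@inr_inj _ _)).
  by case: ifP => _; rewrite inordE.
have : \sum_i fiber_size d i = a + 3.
  by rewrite sum_fiber_size card_sum !card_ord na3.
rewrite !big_ord_recl big_ord0.
have o0 : ord0 = inord 0 :> 'I_3 by apply: val_inj; rewrite /= inordK.
have o1 : lift ord0 ord0 = inord 1 :> 'I_3 by apply: val_inj; rewrite /= inordK.
rewrite o1 {1}o0 size0 size1 => sum_sizes.
case=> -[|[|[|//]]] hi /=.
- by rewrite -[RHS]size0; congr fiber_size; apply: val_inj; rewrite /= inordK.
- by rewrite -[RHS]size1; congr fiber_size; apply: val_inj; rewrite /= inordK.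
have -> : Ordinal hi = lift ord0 (lift ord0 ord0) by apply: val_inj.
lia.
Qed.

Lemma perm_two_values (p : nat) (s : seq nat) : {in s, forall m, m = 1 \/ m = p} ->
  exists2 j, j <= size s & perm_eq s (nseq j p ++ nseq (size s - j) 1).
Proof.
elim: s => [|m s IHs] sP; first by exists 0.
have [|j js jP] := IHs; first by move=> x xs; apply: sP; rewrite inE xs orbT.
have [->|->] := sP m (mem_head _ _); last first.
  by exists j.+1; rewrite //= subSS perm_cons.
exists j; first exact: leq_trans js (leqnSn _).
by rewrite subSn //= perm_sym -[1 :: nseq _ _]cat1s perm_catCA /= perm_cons perm_sym.
Qed.

Section Shapes.
Variables (n : nat) (G : rel 'I_n).

Lemma multipartite_shape_iso k p : multipartite_shape G k p ->
  exists2 j, j <= k & n = j * p + (k - j)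
    /\ graph_iso G (@complete_multipartite (nseq j p ++ nseq (k - j) 1)).
Proof.
move=> [c [_ GE sizes]].
have [|j] := @perm_two_values p [seq fiber_size c i | i <- enum 'I_k].
  by move=> m /mapP[i _ ->]; apply: sizes.
rewrite size_map size_enum_ord => jk perm_j; exists j => //; split.
  have := perm_sumn perm_j.
  rewrite sumn_cat !sumn_nseq mul1n mulnC => <-.
  by rewrite -[LHS](card_ord n) -(sum_fiber_size c) sumnE big_map big_enum.
have [c' [sz' c'E]] := reorder_classes perm_j.
by apply/iso_multipartiteP; exists c'; split=> // x y; rewrite c'E.
Qed.

Lemma multipartite_shape_of_iso t p :
    graph_iso G (@complete_multipartite t) ->
    all (fun m => (0 < m) && ((m == 1) || (m == p))) t ->
  multipartite_shape G (size t) p.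
Proof.
move=> /iso_multipartiteP[c [sz GE]] /(all_nthP 0) tP; exists c; split=> // i.
  by rewrite sz; have /andP[] := tP i (ltn_ord i).
by rewrite sz; have /andP[_ /orP[]/eqP] := tP i (ltn_ord i); [left|right].
Qed.

(** The function [t] lists the sizes, for [j] classes of size [p] besides the
    exceptional one, in the order in which the graph is to be named; the equation
    for [n] is available because it excludes some [j]. *)
Lemma near_multipartite_shape_iso k p e t : near_multipartite_shape G k p e ->
    (forall j, j <= k.-1 -> n = (if e then p else 2) + (j * p + (k.-1 - j)) ->
       perm_eq ((if e then p else 2) :: nseq j p ++ nseq (k.-1 - j) 1) (t j)) ->
  exists j, [/\ j <= k.-1, n = (if e then p else 2) + (j * p + (k.-1 - j))
    & if e then iso_add_edge G (@complete_multipartite (t j))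
      else graph_iso G (@complete_multipartite (t j))].
Proof.
move=> [c [a [b [_ [nab cab] GE sizes size_a]]]] tP.
have mem_ca : c a \in enum 'I_k by rewrite mem_enum.
pose r := rem (c a) (enum 'I_k).
have size_r : size r = k.-1 by rewrite size_rem // size_enum_ord.
have [|j] := @perm_two_values p [seq fiber_size c i | i <- r].
  move=> m /mapP[i ir ->]; apply: sizes; move: ir.
  by rewrite /r rem_filter ?enum_uniq // mem_filter => /andP[].
rewrite size_map size_r => jk perm_j.
have perm_c : perm_eq [seq fiber_size c i | i <- enum 'I_k]
    ((if e then p else 2) :: nseq j p ++ nseq (k.-1 - j) 1).
  rewrite (permPl (perm_map _ (perm_to_rem mem_ca))) /= size_a perm_cons.
  exact: perm_j.
have nE : n = (if e then p else 2) + (j * p + (k.-1 - j)).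
  have := perm_sumn perm_c.
  rewrite /= sumn_cat !sumn_nseq mul1n [p * j]mulnC => <-.
  by rewrite -[LHS](card_ord n) -(sum_fiber_size c) sumnE big_map big_enum.
have [c' [sz' c'E]] := reorder_classes (perm_trans perm_c (tP j jk nE)).
exists j; split=> //; case: e GE {sz' size_a perm_c nE tP} (sz') => GE sz'.
  apply/iso_add_edge_multipartiteP; exists c', a, b; split=> // [|x y].
    by apply/eqP; rewrite c'E cab.
  by rewrite c'E GE.
by apply/iso_multipartiteP; exists c'; split=> // x y; rewrite c'E GE orbF.
Qed.

(** The class of the added edge has at least two members, so it is one of the
    classes of size [p]. *)
Lemma near_multipartite_shape_of_add_edge t p :
    iso_add_edge G (@complete_multipartite t) ->
    all (fun m => (0 < m) && ((m == 1) || (m == p))) t ->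
  near_multipartite_shape G (size t) p true.
Proof.
move=> /iso_add_edge_multipartiteP[c [a [b [sz nab cab GE]]]] /(all_nthP 0) tP.
have sizes i : fiber_size c i = 1 \/ fiber_size c i = p.
  by rewrite sz; have /andP[_ /orP[]/eqP] := tP i (ltn_ord i); [left|right].
exists c, a, b; split=> //.
  by move=> i; rewrite sz; have /andP[] := tP i (ltn_ord i).
have [s1|//] := sizes (c a).
by rewrite (singleton_class s1 (esym cab)) eqxx in nab.
Qed.

Lemma near_multipartite_shape_of_iso t p (i0 : 'I_(size t)) :
    graph_iso G (@complete_multipartite t) ->
    nth 0 t i0 = 2 ->
    (forall i : 'I_(size t), i != i0 -> 0 < nth 0 t i /\ (nth 0 t i = 1 \/ nth 0 t i = p)) ->
  near_multipartite_shape G (size t) p false.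
Proof.
move=> /iso_multipartiteP[c [sz GE]] t2 tP.
have [a [b [/eqP ca /eqP cb nab]]] : exists a b, [/\ c a == i0, c b == i0 & a != b].
  by apply/card_gt1P; rewrite -[#|_|]/(fiber_size c i0) sz t2.
exists c, a, b; split.
- by move=> i; rewrite sz; have [->|/tP[]//] := eqVneq i i0; rewrite t2.
- by rewrite ca cb.
- by move=> x y; rewrite GE orbF.
- by move=> i; rewrite ca sz => /tP[].
- by rewrite ca sz t2.
Qed.

End Shapes.

(** * Largest eigenvalue of multiplicity [n - 4] *)

Theorem theorem3p1 (R : realType) (n : nat) (G : rel 'I_n) :
  6 <= n -> simple_graph G -> connected_graph G ->
  ([/\ dl_multiplicity G (dl_eigenvalue R G 1) = n - 4,
       dl_eigenvalue R G (n - 1) = n%:R%R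
     & dl_multiplicity G (n%:R%R : R) = 3]
   <->
   [\/ n = 0 %[mod 4] /\
       graph_iso G (@complete_multipartite [:: n %/ 4; n %/ 4; n %/ 4; n %/ 4]),
       n = 1 %[mod 3] /\
       graph_iso G (@complete_multipartite
                      [:: (n - 1) %/ 3; (n - 1) %/ 3; (n - 1) %/ 3; 1]),
       n = 2 %[mod 2] /\
       graph_iso G (@complete_multipartite
                      [:: (n - 2) %/ 2; (n - 2) %/ 2; 1; 1])
     | graph_iso G (@complete_split n (n - 3))])
  /\
  ([/\ dl_multiplicity G (dl_eigenvalue R G 1) = n - 4,
       dl_eigenvalue R G (n - 1) = n%:R%R
     & dl_multiplicity G (n%:R%R : R) = 2]
   <->
   (iso_add_edge G (@complete_split n (n - 2)) \/
    (exists a b, [/\ @complete_split n (n - 3) a b,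
        degree (@complete_split n (n - 3)) a = n - 1,
        degree (@complete_split n (n - 3)) b = n - 1
      & graph_iso G (del_edge (@complete_split n (n - 3)) a b)]) \/
    (exists p, [/\ n = 2 * p + 1, 3 <= p
      & iso_add_edge G (@complete_multipartite [:: p; p; 1])]) \/
    (exists p, [/\ n = 2 * p + 2, 3 <= p
      & graph_iso G (@complete_multipartite [:: p; p; 2])]) \/
    (exists p, [/\ n = 3 * p, 3 <= p
      & iso_add_edge G (@complete_multipartite [:: p; p; p])]))).
Proof.
move=> n6 simple_G _.
have split_iso a k : n - a = k ->
    graph_iso (@complete_split n a) (@complete_multipartite (a :: nseq k 1)).
  by move=> <-; apply: complete_split_multipartite.
have n3 : n - (n - 3) = 3 by lia.
have n2 : n - (n - 2) = 2 by lia.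
have spec_a := @multipartite_spectrumP R n 4 G simple_G isT.
have spec_b := @near_multipartite_spectrumP R n 3 G simple_G isT.
split.
  rewrite spec_a ?(leq_trans _ n6) //; split.
    move=> [p p_gt1 /multipartite_shape_iso[j j_le4 [nE isoG]]].
    case: j j_le4 nE isoG => [|[|[|[|[|//]]]]] _ /= nE isoG; first by lia.
    - apply: Or44; have np : p = n - 3 by lia.
      rewrite np in isoG.
      exact: graph_iso_trans isoG (graph_iso_sym (split_iso _ _ n3)).
    - by apply: Or43; split; [lia | have -> : (n - 2) %/ 2 = p by lia].
    - by apply: Or42; split; [lia | have -> : (n - 1) %/ 3 = p by lia].
    - by apply: Or41; split; [lia | have -> : n %/ 4 = p by lia].
  case=> [[n_mod isoG]|[n_mod isoG]|[n_mod isoG]|isoG].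
  - exists (n %/ 4); first by lia.
    by apply: (multipartite_shape_of_iso isoG); rewrite /= eqxx !orbT !andbT; lia.
  - exists ((n - 1) %/ 3); first by lia.
    by apply: (multipartite_shape_of_iso isoG); rewrite /= eqxx !orbT !andbT; lia.
  - exists ((n - 2) %/ 2); first by lia.
    by apply: (multipartite_shape_of_iso isoG); rewrite /= eqxx !orbT !andbT; lia.
  - exists (n - 3); first by lia.
    have {}isoG := graph_iso_trans isoG (split_iso _ _ n3).
    by apply: (multipartite_shape_of_iso isoG); rewrite /= eqxx !orbT !andbT; lia.
rewrite spec_b ?(leq_trans _ n6) //; split.
  move=> [p [e [p_gt2]]]; case: e => shape.
    have [j [j_le2 nE isoG]] :=
      near_multipartite_shape_iso shape (fun _ _ _ => perm_refl _).
    case: j j_le2 nE isoG => [|[|[|//]]] _ /= nE isoG.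
    - left; have np : p = n - 2 by lia.
      rewrite np in isoG.
      exact: iso_add_edge_trans isoG (graph_iso_sym (split_iso _ _ n2)).
    - by do 2 right; left; exists p; split=> //; lia.
    - by do 4 right; exists p; split=> //; lia.
  pose t j := if j is 2 then [:: p; p; 2] else [:: p; 2; 1].
  have [|j [j_le2 nE isoG]] := near_multipartite_shape_iso (t := t) shape.
    by case=> [|[|[|//]]] _ nE; [lia | |]; apply/seq.permP => P /=; lia.
  case: j j_le2 nE isoG => [|[|[|//]]] _ /= nE isoG; first by lia.
  - right; left; pose i : 'I_(n - (n - 3)) := cast_ord (esym n3) ord0.
    pose j : 'I_(n - (n - 3)) := cast_ord (esym n3) ord_max.
    exists (inr i), (inr j); split.
    + by [].
    + by apply: degree_complete_split_clique; lia.
    + by apply: degree_complete_split_clique; lia.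
    have np : p = n - 3 by lia.
    rewrite np in isoG; apply: graph_iso_trans isoG (graph_iso_sym _).
    exact: del_edge_complete_split.
  - by do 3 right; left; exists p; split=> //; lia.
case=> [isoG|[[a [b [Hab deg_a deg_b isoG]]]|[[p [nE p3 isoG]]|[[p [nE p3 isoG]]|[p [nE p3 isoG]]]]]].
- exists (n - 2), true; split; first by lia.
  have {}isoG := iso_add_edge_trans isoG (split_iso _ _ n2).
  by apply: (near_multipartite_shape_of_add_edge isoG);
    rewrite /= eqxx !orbT !andbT; lia.
- exists (n - 3), false; split; first by lia.
  case: a b Hab deg_a deg_b isoG => [x|i] [y|j]; rewrite ?degree_complete_split_indep;
    try lia.
  move=> Hij _ _ isoG.
  have nij : i != j.
    by case/andP: Hij => + _; rewrite (inj_eq (@inr_inj _ _)).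
  have {}isoG := graph_iso_trans isoG (del_edge_complete_split n3 nij).
  pose i1 : 'I_(size [:: n - 3; 2; 1]) := Ordinal (isT : 1 < 3).
  apply: (@near_multipartite_shape_of_iso _ _ _ _ i1 isoG) => //.
  by case=> -[|[|[|//]]] // hi _ /=; split; [lia | right | |left].
- exists p, true; split=> //.
  by apply: (near_multipartite_shape_of_add_edge isoG); rewrite /= eqxx !orbT !andbT; lia.
- exists p, false; split=> //.
  pose i2 : 'I_(size [:: p; p; 2]) := Ordinal (isT : 2 < 3).
  apply: (@near_multipartite_shape_of_iso _ _ _ _ i2 isoG) => //.
  by case=> -[|[|[|//]]] // hi _ /=; split; [lia | right | lia | right].
- exists p, true; split=> //.
  by apply: (near_multipartite_shape_of_add_edge isoG); rewrite /= eqxx !orbT !andbT; lia.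
Qed.
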